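(* Let $f_1,f_2,\dots,f_j$ be transcendental entire functions and suppose that $f_1$ is strongly log-regular. Then $g= f_1 \circ f_2 \circ\cdots\circ f_j$ is strongly log-regular.
   Context: For a transcendental entire function $f$, $M(r)=M(r,f)=\max_{|z|=r}|f(z)|$ for $r>0$. A transcendental entire function $f$ is strongly log-regular if, for every $\varepsilon\in(0,1)$, there exist $R>0$ and $k>1$ such that $\log M(r^k,f)\ge(k\log M(r,f))^{1/\varepsilon}$ for all $r>R$. *)

(* Defs.v *)
From Stdlib Require Export Reals.
From Coquelicot Require Export Coquelicot.

Open Scope R_scope.

Definition entire (f : C -> C) : Prop :=
  forall z : C, @ex_derive C_AbsRing C_NormedModule f z.

Definition polynomial_function (p : C -> C) : Prop :=
  exists (n : nat) (a : nat -> C),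
    forall z : C, p z = sum_n (fun k => (a k * z ^ k)%C) n.

Definition transcendental_entire (f : C -> C) : Prop :=
  entire f /\ ~ polynomial_function f.

(* For entire [f] and [r >= 0] the set is the continuous image of a nonempty
   compact circle, so its least upper bound is finite and is its maximum. *)
Definition max_modulus (f : C -> C) (r : R) : R :=
  real (Lub_Rbar (fun x : R => exists z : C, Cmod z = r /\ x = Cmod (f z))).

(* [Rpower x y] is exp (y ln x), the real power for x > 0.  The base
   [k * ln (max_modulus f r)] is positive for large [r] when [f] is
   transcendental entire; as [R0] may be increased, the conventional values of
   [Rpower] and [ln] outside their domain do not affect the definition. *)
Definition strongly_log_regular (f : C -> C) : Prop :=
  transcendental_entire f /\
  forall eps : R, 0 < eps < 1 ->
    exists R0 k : R, 0 < R0 /\ 1 < k /\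
      forall r : R, R0 < r ->
        ln (max_modulus f (Rpower r k))
          >= Rpower (k * ln (max_modulus f r)) (1 / eps).

(* [compose_upto f j] is f 1 o f 2 o ... o f j; the value [f 0] is not used. *)
Fixpoint compose_upto (f : nat -> C -> C) (j : nat) (z : C) : C :=
  match j with
  | O => z
  | S i => compose_upto f i (f (S i) z)
  end.

(* Main.v *)
Require Import Defs.
From Stdlib Require Import Reals Lra Lia Factorial Classical ClassicalEpsilon.
From Coquelicot Require Import Coquelicot.

(** Write [M] for the maximum modulus and [g = F o G] with [F] strongly
    log-regular.  Clearly [M(r, g) <= M(t, F)] with [t = M(r, G)].  In the other
    direction, a form of Polya's theorem gives [M(s, g) >= M(rho, F)] as soon as
    [M(s/3, G) > 218 rho].  By the three circles theorem this holds for
    [s = r^k'] and [rho = t^k] when [k'] is large compared with [k], so that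
    [log M(r^k', g) >= log M(t^k, F) >= (k log M(t, F))^(2/eps)
     >= (k log M(r, g))^(2/eps)], and the gain from [1/eps] to [2/eps] absorbs the
    replacement of [k] by [k'].  The same growth, against [M(r, g) >= c r - d],
    shows that [g] is not a polynomial.

    All the complex analysis is deduced from the maximum principle, which follows
    from Goursat's lemma for rectangles applied to [f (a + exp z)].  No power
    series or contour integral is needed. *)

(** * Complex continuity and differentiability *)

(** The main obstacle is to make the constant in Polya's theorem independent of [F]. A strict
    inequality M(r, F o G) < M(rho, F) only keeps [G] at distance [rho d] from the chosen points
    [w t], and [d], which comes from a Lipschitz constant of [F], can be arbitrarily small. In a
    product of [n] factors with equidistant moduli [t], the reverse triangle inequality alone
    controls all factors but one: [|G z|] can be close to few of the [t]. Thus [d] enters the lower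
    bound to the first power only, and its [n]-th root tends to 1.

    The remaining losses are an additive constant in the three circles theorem, the factor 218, and
    the division of the radius by 3. The first two are outweighed by log M(r, G), which tends to
    infinity; the third is paid for by one spare power of [r]. *)

Definition ccont (f : C -> C) (a : C) : Prop :=
  forall eps, 0 < eps -> exists d, 0 < d /\
    forall z, Cmod (z - a) < d -> Cmod (f z - f a) < eps.

(* Caratheodory's form of complex differentiability: sums, products and
   compositions then only require the continuity of the slope [phi]. *)
Definition cdiff (f : C -> C) (a : C) : Prop :=
  exists phi r, 0 < r /\ ccont phi a /\
    forall z, Cmod (z - a) < r -> (f z - f a)%C = (phi z * (z - a))%C.

Lemma Cmod_minus_sym (x y : C) : Cmod (x - y) = Cmod (y - x).
Proof. rewrite <- Cmod_opp; f_equal; ring. Qed.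

Lemma Cmod_triangle_rev (x y : C) : Cmod x - Cmod y <= Cmod (x - y).
Proof.
  pose proof (Cmod_triangle (x - y) y) as H.
  replace (x - y + y)%C with x in H by ring. lra.
Qed.

Lemma Cmod_triangle_minus (x y : C) : Cmod (x - y) <= Cmod x + Cmod y.
Proof.
  pose proof (Cmod_triangle x (- y)) as H. rewrite Cmod_opp in H. exact H.
Qed.

Lemma Cmod_self_minus (a : C) : Cmod (a - a) = 0.
Proof. replace (a - a)%C with (0 : C) by ring. apply Cmod_0. Qed.

Lemma ccont_ext_loc (f g : C -> C) (a : C) (r : R) :
  0 < r -> (forall z, Cmod (z - a) < r -> f z = g z) -> ccont g a -> ccont f a.
Proof.
  intros Hr E Hg eps He. destruct (Hg eps He) as (d & Hd & H).
  exists (Rmin d r). split. { now apply Rmin_pos. }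
  intros z Hz. rewrite (E z), (E a).
  - apply H. eapply Rlt_le_trans; [exact Hz | apply Rmin_l].
  - rewrite Cmod_self_minus; lra.
  - eapply Rlt_le_trans; [exact Hz | apply Rmin_r].
Qed.

Lemma ccont_const (c a : C) : ccont (fun _ => c) a.
Proof.
  intros eps He. exists 1. split; [lra|]. intros z _. rewrite Cmod_self_minus; lra.
Qed.

Lemma ccont_id (a : C) : ccont (fun z => z) a.
Proof. intros eps He. exists eps. now split. Qed.

Lemma ccont_plus (f g : C -> C) (a : C) :
  ccont f a -> ccont g a -> ccont (fun z => f z + g z)%C a.
Proof.
  intros Hf Hg eps He.
  destruct (Hf (eps / 2)) as (d1 & Hd1 & H1); [lra|].
  destruct (Hg (eps / 2)) as (d2 & Hd2 & H2); [lra|].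
  exists (Rmin d1 d2). split. { now apply Rmin_pos. }
  intros z Hz.
  specialize (H1 z (Rlt_le_trans _ _ _ Hz (Rmin_l _ _))).
  specialize (H2 z (Rlt_le_trans _ _ _ Hz (Rmin_r _ _))).
  replace (f z + g z - (f a + g a))%C with ((f z - f a) + (g z - g a))%C by ring.
  pose proof (Cmod_triangle (f z - f a) (g z - g a)). lra.
Qed.

Lemma ccont_mult (f g : C -> C) (a : C) :
  ccont f a -> ccont g a -> ccont (fun z => f z * g z)%C a.
Proof.
  intros Hf Hg eps He.
  pose proof (Cmod_ge_0 (f a)) as Pf. pose proof (Cmod_ge_0 (g a)) as Pg.
  set (S := 1 + Cmod (f a) + Cmod (g a)).
  assert (HS : 0 < S) by (unfold S; lra).
  set (eta := Rmin 1 (eps / S)).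
  assert (Heta : 0 < eta) by (apply Rmin_pos; [lra | now apply Rdiv_lt_0_compat]).
  assert (Heta1 : eta <= 1) by apply Rmin_l.
  assert (HetaS : eta * S <= eps).
  { replace eps with (eps / S * S) by (field; lra).
    apply Rmult_le_compat_r; [lra | apply Rmin_r]. }
  destruct (Hf eta Heta) as (d1 & Hd1 & H1).
  destruct (Hg eta Heta) as (d2 & Hd2 & H2).
  exists (Rmin d1 d2). split. { now apply Rmin_pos. }
  intros z Hz.
  specialize (H1 z (Rlt_le_trans _ _ _ Hz (Rmin_l _ _))).
  specialize (H2 z (Rlt_le_trans _ _ _ Hz (Rmin_r _ _))).
  replace (f z * g z - f a * g a)%C
    with ((f z - f a) * (g z - g a) + (f a * (g z - g a) + (f z - f a) * g a))%C
    by ring.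
  pose proof (Cmod_triangle ((f z - f a) * (g z - g a))
                (f a * (g z - g a) + (f z - f a) * g a)) as T1.
  pose proof (Cmod_triangle (f a * (g z - g a)) ((f z - f a) * g a)) as T2.
  rewrite Cmod_mult in T1. rewrite !Cmod_mult in T2.
  pose proof (Cmod_ge_0 (f z - f a)). pose proof (Cmod_ge_0 (g z - g a)).
  assert (Cmod (f z - f a) * Cmod (g z - g a) <= Cmod (f z - f a) * 1)
    by (apply Rmult_le_compat_l; lra).
  assert (Cmod (f a) * Cmod (g z - g a) <= Cmod (f a) * eta)
    by (apply Rmult_le_compat_l; lra).
  assert (Cmod (f z - f a) * Cmod (g a) <= eta * Cmod (g a))
    by (apply Rmult_le_compat_r; lra).
  unfold S in HetaS. lra.
Qed.

Lemma ccont_inv (f : C -> C) (a : C) :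
  f a <> 0 -> ccont f a -> ccont (fun z => / f z)%C a.
Proof.
  intros Ha Hf eps He.
  pose proof (proj1 (Cmod_gt_0 _) Ha) as Pa.
  set (m := Cmod (f a)) in *.
  set (eta := Rmin (m / 2) (eps * (m * m) / 2)).
  assert (Heta : 0 < eta).
  { apply Rmin_pos; [lra|]. apply Rdiv_lt_0_compat; [|lra].
    repeat apply Rmult_lt_0_compat; lra. }
  destruct (Hf eta Heta) as (d & Hd & H).
  exists d. split; [exact Hd|]. intros z Hz. specialize (H z Hz).
  assert (Hz1 : m / 2 < Cmod (f z)).
  { pose proof (Cmod_triangle_rev (f a) (f z)) as T.
    rewrite Cmod_minus_sym in T. fold m in T.
    assert (eta <= m / 2) by apply Rmin_l. lra. }
  assert (Hz0 : f z <> 0) by (apply Cmod_gt_0; lra).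
  replace (/ f z - / f a)%C with ((f a - f z) * (/ f z * / f a))%C
    by (field; now split).
  rewrite !Cmod_mult, !Cmod_inv by assumption. rewrite Cmod_minus_sym. fold m.
  assert (He2 : Cmod (f z - f a) < eps * (m * m) / 2)
    by (eapply Rlt_le_trans; [exact H | apply Rmin_r]).
  apply Rmult_lt_reg_r with (Cmod (f z) * m). { apply Rmult_lt_0_compat; lra. }
  replace (Cmod (f z - f a) * (/ Cmod (f z) * / m) * (Cmod (f z) * m))
    with (Cmod (f z - f a)) by (field; lra).
  eapply Rlt_le_trans; [exact He2|].
  replace (eps * (m * m) / 2) with (eps * (m / 2 * m)) by field.
  apply Rmult_le_compat_l; [lra|]. apply Rmult_le_compat_r; lra.
Qed.

Lemma ccont_comp (f g : C -> C) (a : C) :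
  ccont g a -> ccont f (g a) -> ccont (fun z => f (g z)) a.
Proof.
  intros Hg Hf eps He.
  destruct (Hf eps He) as (d & Hd & H). destruct (Hg d Hd) as (d' & Hd' & H').
  exists d'. split; auto.
Qed.

Lemma cdiff_ccont (f : C -> C) (a : C) : cdiff f a -> ccont f a.
Proof.
  intros (phi & r & Hr & Hphi & E).
  apply (ccont_ext_loc _ (fun z => f a + phi z * (z + - a))%C a r Hr).
  - intros z Hz. specialize (E z Hz).
    replace (f z) with (f z - f a + f a)%C by ring. rewrite E. ring.
  - apply ccont_plus; [apply ccont_const|]. apply ccont_mult; [exact Hphi|].
    apply ccont_plus; [apply ccont_id | apply ccont_const].
Qed.

Lemma cdiff_ext_loc (f g : C -> C) (a : C) (r : R) :
  0 < r -> (forall z, Cmod (z - a) < r -> f z = g z) -> cdiff g a -> cdiff f a.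
Proof.
  intros Hr E (phi & r' & Hr' & Hphi & Eg).
  exists phi, (Rmin r r'). split; [now apply Rmin_pos|]. split; [exact Hphi|].
  intros z Hz. rewrite (E z), (E a).
  - apply Eg. eapply Rlt_le_trans; [exact Hz | apply Rmin_r].
  - rewrite Cmod_self_minus; lra.
  - eapply Rlt_le_trans; [exact Hz | apply Rmin_l].
Qed.

Lemma cdiff_const (c a : C) : cdiff (fun _ => c) a.
Proof.
  exists (fun _ => 0), 1. split; [lra|]. split; [apply ccont_const|].
  intros; ring.
Qed.

Lemma cdiff_id (a : C) : cdiff (fun z => z) a.
Proof.
  exists (fun _ => 1), 1. split; [lra|]. split; [apply ccont_const|].
  intros; ring.
Qed.

Lemma cdiff_plus (f g : C -> C) (a : C) :
  cdiff f a -> cdiff g a -> cdiff (fun z => f z + g z)%C a.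
Proof.
  intros (p & r & Hr & Hp & Ep) (q & s & Hs & Hq & Eq).
  exists (fun z => p z + q z)%C, (Rmin r s).
  split; [now apply Rmin_pos|]. split; [now apply ccont_plus|].
  intros z Hz.
  specialize (Ep z (Rlt_le_trans _ _ _ Hz (Rmin_l _ _))).
  specialize (Eq z (Rlt_le_trans _ _ _ Hz (Rmin_r _ _))).
  replace (f z + g z - (f a + g a))%C with ((f z - f a) + (g z - g a))%C by ring.
  rewrite Ep, Eq. ring.
Qed.

Lemma cdiff_mult (f g : C -> C) (a : C) :
  cdiff f a -> cdiff g a -> cdiff (fun z => f z * g z)%C a.
Proof.
  intros Hf Hg. pose proof (cdiff_ccont f a Hf) as Cf.
  destruct Hf as (p & r & Hr & Hp & Ep). destruct Hg as (q & s & Hs & Hq & Eq).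
  exists (fun z => f z * q z + p z * g a)%C, (Rmin r s).
  split; [now apply Rmin_pos|]. split.
  { apply ccont_plus; apply ccont_mult; auto using ccont_const. }
  intros z Hz.
  specialize (Ep z (Rlt_le_trans _ _ _ Hz (Rmin_l _ _))).
  specialize (Eq z (Rlt_le_trans _ _ _ Hz (Rmin_r _ _))).
  replace (f z * g z - f a * g a)%C
    with (f z * (g z - g a) + (f z - f a) * g a)%C by ring.
  rewrite Ep, Eq. ring.
Qed.

Lemma ccont_neq_0 (f : C -> C) (a : C) :
  f a <> 0 -> ccont f a ->
  exists r, 0 < r /\ forall z, Cmod (z - a) < r -> f z <> 0.
Proof.
  intros Ha Hf. destruct (Hf (Cmod (f a))) as (d & Hd & H).
  { now apply Cmod_gt_0. }
  exists d. split; [exact Hd|]. intros z Hz E. specialize (H z Hz).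
  rewrite E in H. rewrite Cmod_minus_sym in H.
  replace (f a - 0)%C with (f a) in H by ring. lra.
Qed.

Lemma cdiff_inv (f : C -> C) (a : C) :
  f a <> 0 -> cdiff f a -> cdiff (fun z => / f z)%C a.
Proof.
  intros Ha Hf. pose proof (cdiff_ccont f a Hf) as Cf.
  destruct (ccont_neq_0 f a Ha Cf) as (s & Hs & Nz).
  destruct Hf as (p & r & Hr & Hp & Ep).
  exists (fun z => p z * (- / f a * / f z))%C, (Rmin r s).
  split; [now apply Rmin_pos|]. split.
  { apply ccont_mult; [exact Hp|].
    apply ccont_mult; [apply ccont_const | now apply ccont_inv]. }
  intros z Hz.
  specialize (Ep z (Rlt_le_trans _ _ _ Hz (Rmin_l _ _))).
  specialize (Nz z (Rlt_le_trans _ _ _ Hz (Rmin_r _ _))).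
  replace (/ f z - / f a)%C with (- (f z - f a) * / f a * / f z)%C
    by (field; now split).
  rewrite Ep. ring.
Qed.

Lemma cdiff_comp (f g : C -> C) (a : C) :
  cdiff g a -> cdiff f (g a) -> cdiff (fun z => f (g z)) a.
Proof.
  intros Hg Hf. pose proof (cdiff_ccont g a Hg) as Cg.
  destruct Hg as (p & r & Hr & Hp & Ep). destruct Hf as (q & s & Hs & Hq & Eq).
  destruct (Cg s Hs) as (d & Hd & Hgd).
  exists (fun z => q (g z) * p z)%C, (Rmin r d).
  split; [now apply Rmin_pos|]. split.
  { apply ccont_mult; [now apply ccont_comp | exact Hp]. }
  intros z Hz.
  specialize (Ep z (Rlt_le_trans _ _ _ Hz (Rmin_l _ _))).
  specialize (Hgd z (Rlt_le_trans _ _ _ Hz (Rmin_r _ _))).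
  rewrite (Eq _ Hgd), Ep. ring.
Qed.

Lemma cdiff_pow (f : C -> C) (n : nat) (a : C) :
  cdiff f a -> cdiff (fun z => f z ^ n)%C a.
Proof.
  intros Hf. induction n as [|n IH]; simpl; [apply cdiff_const|].
  now apply cdiff_mult.
Qed.

(** The bridge to the derivative used in [entire]: the slope is the difference quotient, completed
    at [a] by the derivative. *)
Lemma ex_derive_cdiff (f : C -> C) (a : C) :
  @ex_derive C_AbsRing C_NormedModule f a <-> cdiff f a.
Proof.
  split.
  - intros (l & Hlin & Hd). specialize (Hd a (fun P H => H)).
    exists (fun z => if Ceq_dec z a then l else ((f z - f a) / (z - a))%C), 1.
    split; [lra|]. split.
    + intros eps He.
      assert (He2 : 0 < eps / 2) by lra.
      destruct (Hd (mkposreal _ He2)) as (d & Hd').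
      exists d. split; [apply cond_pos|]. intros z Hz.
      destruct (Ceq_dec a a) as [_|]; [|easy].
      destruct (Ceq_dec z a) as [E|N]. { rewrite Cmod_self_minus; lra. }
      specialize (Hd' z Hz).
      change (Cmod ((f z - f a) - (z - a) * l)
                <= (eps / 2) * Cmod (z - a)) in Hd'.
      assert (Nz : (z - a)%C <> 0).
      { intros E. apply N. now apply Ceq_minus. }
      pose proof (proj1 (Cmod_gt_0 _) Nz) as Pz.
      replace ((f z - f a) / (z - a) - l)%C
        with ((f z - f a - (z - a) * l) / (z - a))%C by (field; exact Nz).
      rewrite Cmod_div by exact Nz.
      apply Rle_lt_trans with (eps / 2); [|lra].
      apply Rmult_le_reg_r with (Cmod (z - a)); [exact Pz|].
      unfold Rdiv at 1. rewrite Rmult_assoc, Rinv_l by lra. lra.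
    + intros z _. destruct (Ceq_dec z a) as [->|N].
      * ring.
      * field. intros E. apply N. now apply Ceq_minus.
  - intros (phi & r & Hr & Hphi & E). exists (phi a : C_NormedModule). split.
    { apply is_linear_scal_l. }
    (* The remainder estimate is demanded at every limit point of the filter of neighbourhoods of
       [a]; the only one is [a]. *)
    intros x Hx.
    apply (@is_filter_lim_locally_unique C_AbsRing
             (AbsRing_NormedModule C_AbsRing)) in Hx.
    change (a = x) in Hx. subst x.
    intros eps. destruct (Hphi eps (cond_pos eps)) as (d & Hd & H).
    exists (mkposreal _ (Rmin_pos _ _ Hr Hd)). intros z Hz.
    change (Cmod (z - a) < Rmin r d) in Hz.
    change (Cmod ((f z - f a) - (z - a) * phi a) <= eps * Cmod (z - a)).
    rewrite (E z) by (eapply Rlt_le_trans; [exact Hz | apply Rmin_l]).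
    replace (phi z * (z - a) - (z - a) * phi a)%C
      with ((phi z - phi a) * (z - a))%C by ring.
    rewrite Cmod_mult. apply Rmult_le_compat_r; [apply Cmod_ge_0|].
    left. apply H. eapply Rlt_le_trans; [exact Hz | apply Rmin_r].
Qed.

Lemma entire_cdiff (f : C -> C) : entire f <-> forall z, cdiff f z.
Proof. unfold entire. split; intros H z; now apply ex_derive_cdiff. Qed.

Lemma entire_comp (f g : C -> C) :
  entire f -> entire g -> entire (fun z => f (g z)).
Proof. rewrite !entire_cdiff. intros Hf Hg z. now apply cdiff_comp. Qed.

(** * Compactness and Goursat's lemma *)

(** Left, right, bottom and top; the bundling allows a recursion producing nested rectangles. *)
Record rectangle := Rect { rl : R; rr : R; rb : R; rt : R }.

(* Bisection: a bad rectangle would yield bad rectangles shrinking to a point. *)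
Lemma rectangle_bisection (P : R -> R -> R -> R -> Prop) (a b c d : R) :
  a <= b -> c <= d ->
  (forall a b c d, a <= b -> c <= d ->
     P a ((a + b) / 2) c ((c + d) / 2) -> P ((a + b) / 2) b c ((c + d) / 2) ->
     P a ((a + b) / 2) ((c + d) / 2) d -> P ((a + b) / 2) b ((c + d) / 2) d ->
     P a b c d) ->
  (forall x y, a <= x <= b -> c <= y <= d -> exists eta, 0 < eta /\
     forall a' b' c' d', a' <= x <= b' -> c' <= y <= d' ->
       b' - a' < eta -> d' - c' < eta -> P a' b' c' d') ->
  P a b c d.
Proof.
  intros Hab Hcd Hsplit Hloc. apply NNPP. intros Hbad.
  set (bad := fun q => rl q <= rr q /\ rb q <= rt q /\
                       ~ P (rl q) (rr q) (rb q) (rt q)).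
  set (rel := fun q q' => rl q <= rl q' /\ rr q' <= rr q /\ rb q <= rb q' /\
                rt q' <= rt q /\ rr q' - rl q' = (rr q - rl q) / 2 /\
                rt q' - rb q' = (rt q - rb q) / 2).
  (* A bad rectangle has a bad quarter. Carrying the badness in the type makes the choice of a
     quarter a function that can be iterated. *)
  assert (Hstep : forall q : sig bad, { q' : sig bad | rel (proj1_sig q) (proj1_sig q') }).
  { intros [[a0 b0 c0 d0] (H1 & H2 & H3)]. simpl in H1, H2, H3.
    apply constructive_indefinite_description. simpl.
    set (m := (a0 + b0) / 2). set (n := (c0 + d0) / 2).
    assert (Hm : a0 <= m <= b0 /\ m - a0 = (b0 - a0) / 2 /\ b0 - m = (b0 - a0) / 2)
      by (unfold m; lra).
    assert (Hn : c0 <= n <= d0 /\ n - c0 = (d0 - c0) / 2 /\ d0 - n = (d0 - c0) / 2)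
      by (unfold n; lra).
    destruct (classic (P a0 m c0 n)) as [Q1|Q1];
    [destruct (classic (P m b0 c0 n)) as [Q2|Q2];
    [destruct (classic (P a0 m n d0)) as [Q3|Q3];
    [destruct (classic (P m b0 n d0)) as [Q4|Q4]|]|]|].
    - exfalso. apply H3. now apply Hsplit.
    - assert (B : bad (Rect m b0 n d0)) by (unfold bad; simpl; repeat split; tauto || lra).
      exists (exist _ _ B). unfold rel; simpl; lra.
    - assert (B : bad (Rect a0 m n d0)) by (unfold bad; simpl; repeat split; tauto || lra).
      exists (exist _ _ B). unfold rel; simpl; lra.
    - assert (B : bad (Rect m b0 c0 n)) by (unfold bad; simpl; repeat split; tauto || lra).
      exists (exist _ _ B). unfold rel; simpl; lra.
    - assert (B : bad (Rect a0 m c0 n)) by (unfold bad; simpl; repeat split; tauto || lra).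
      exists (exist _ _ B). unfold rel; simpl; lra. }
  assert (B0 : bad (Rect a b c d)) by (unfold bad; simpl; tauto).
  set (seq := fix seq (n : nat) : sig bad :=
         match n with O => exist _ _ B0 | S n => proj1_sig (Hstep (seq n)) end).
  set (q := fun n => proj1_sig (seq n)).
  assert (Hrel : forall n, rel (q n) (q (S n))).
  { intros n. unfold q; simpl. apply (proj2_sig (Hstep (seq n))). }
  assert (Hq : forall n, bad (q n)) by (intros n; apply (proj2_sig (seq n))).
  assert (Hnest : forall n k, rl (q n) <= rl (q (n + k)%nat) /\
     rr (q (n + k)%nat) <= rr (q n) /\ rb (q n) <= rb (q (n + k)%nat) /\
     rt (q (n + k)%nat) <= rt (q n)).
  { intros n k. induction k as [|k IH].
    - rewrite Nat.add_0_r. lra.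
    - rewrite Nat.add_succ_r. destruct (Hrel (n + k)%nat) as (?&?&?&?&_). lra. }
  assert (Hcross : forall n m, rl (q n) <= rr (q m) /\ rb (q n) <= rt (q m)).
  { intros n m. destruct (Hnest n m) as (H1 & _ & H2 & _).
    destruct (Hnest m n) as (_ & H3 & _ & H4).
    rewrite (Nat.add_comm m n) in H3, H4.
    destruct (Hq (n + m)%nat) as (H5 & H6 & _). lra. }
  assert (Hwidth : forall n, rr (q n) - rl (q n) = (b - a) * (1 / 2) ^ n /\
                             rt (q n) - rb (q n) = (d - c) * (1 / 2) ^ n).
  { intros n. induction n as [|n IH]; [unfold q; simpl; lra|].
    destruct (Hrel n) as (_&_&_&_&E1&E2). simpl. lra. }
  destruct (completeness (fun x => exists n, x = rl (q n))) as (x & Hx1 & Hx2).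
  { exists (rr (q O)). intros z (n & ->). apply Hcross. }
  { exists (rl (q O)). now exists O. }
  destruct (completeness (fun x => exists n, x = rb (q n))) as (y & Hy1 & Hy2).
  { exists (rt (q O)). intros z (n & ->). apply Hcross. }
  { exists (rb (q O)). now exists O. }
  assert (Hx : forall n, rl (q n) <= x <= rr (q n)).
  { intros n. split; [apply Hx1; now exists n|].
    apply Hx2. intros z (m & ->). apply Hcross. }
  assert (Hy : forall n, rb (q n) <= y <= rt (q n)).
  { intros n. split; [apply Hy1; now exists n|].
    apply Hy2. intros z (m & ->). apply Hcross. }
  destruct (Hloc x y (Hx O) (Hy O)) as (eta & Heta & HP).
  (* The summand 1 keeps the denominator positive for degenerate rectangles; both sides of the
     [N]-th rectangle then become shorter than [eta]. *)
  assert (Hpos : 0 < eta / (1 + (b - a) + (d - c))) by (apply Rdiv_lt_0_compat; lra).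
  destruct (pow_lt_1_zero (1 / 2)) with (y := eta / (1 + (b - a) + (d - c)))
    as (N & HN); [rewrite Rabs_pos_eq; lra | exact Hpos |].
  specialize (HN N (Nat.le_refl N)).
  assert (Hp : 0 < (1 / 2) ^ N) by (apply pow_lt; lra).
  rewrite Rabs_pos_eq in HN by lra.
  assert (Hsmall : (1 + (b - a) + (d - c)) * (1 / 2) ^ N < eta).
  { apply Rlt_le_trans with ((1 + (b - a) + (d - c)) * (eta / (1 + (b - a) + (d - c)))).
    - apply Rmult_lt_compat_l; lra.
    - right; field; lra. }
  assert (Hw1 : 0 <= (b - a) * (1 / 2) ^ N) by (apply Rmult_le_pos; lra).
  assert (Hw2 : 0 <= (d - c) * (1 / 2) ^ N) by (apply Rmult_le_pos; lra).
  destruct (Hq N) as (_ & _ & HnP). destruct (Hwidth N) as (W1 & W2).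
  apply HnP. apply HP; [apply Hx | apply Hy | lra | lra].
Qed.

Lemma Rabs_fst_le_Cmod (z : C) : Rabs (fst z) <= Cmod z.
Proof. eapply Rle_trans; [apply Rmax_l | apply Rmax_Cmod]. Qed.

Lemma Rabs_snd_le_Cmod (z : C) : Rabs (snd z) <= Cmod z.
Proof. eapply Rle_trans; [apply Rmax_r | apply Rmax_Cmod]. Qed.

Lemma Cmod_le_sum (z : C) : Cmod z <= Rabs (fst z) + Rabs (snd z).
Proof.
  pose proof (Rabs_pos (fst z)). pose proof (Rabs_pos (snd z)).
  unfold Cmod. rewrite <- (sqrt_pow2 (Rabs (fst z) + Rabs (snd z))) by lra.
  apply sqrt_le_1_alt. rewrite <- (pow2_abs (fst z)), <- (pow2_abs (snd z)). nra.
Qed.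

Definition rcont (g : C -> R) (a : C) : Prop :=
  forall eps, 0 < eps -> exists d, 0 < d /\
    forall z, Cmod (z - a) < d -> Rabs (g z - g a) < eps.

Definition cclosed (K : C -> Prop) : Prop :=
  forall z, ~ K z -> exists d, 0 < d /\ forall w, Cmod (w - z) < d -> ~ K w.

(** Without a maximum every point of [K] is beaten by some [p] in [K], and by continuity [p] beats
    all of [K] nearby; near a point outside [K] there is nothing to beat. Being beaten by one point
    passes from the four quarters to the rectangle, so a single [p] would beat all of [K], itself
    included. *)
Lemma compact_max (K : C -> Prop) (g : C -> R) (B : R) :
  cclosed K -> (exists z, K z) -> (forall z, K z -> Cmod z <= B) ->
  (forall z, K z -> rcont g z) ->
  exists a, K a /\ forall z, K z -> g z <= g a.
Proof.
  intros Hcl (z0 & Hz0) HB Hg. apply NNPP. intros Hno.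
  assert (Hnx : forall p, K p -> exists c, K c /\ g p < g c).
  { intros p Hp. apply NNPP. intros H. apply Hno. exists p. split; [exact Hp|].
    intros z Hz. apply Rnot_lt_le. intros Hlt. apply H. now exists z. }
  assert (HB0 : 0 <= B) by (eapply Rle_trans; [apply Cmod_ge_0 | apply (HB z0 Hz0)]).
  set (P := fun a b c d => exists p, K p /\
     forall z, K z -> a <= fst z <= b -> c <= snd z <= d -> g z < g p).
  assert (HP : P (- B) B (- B) B).
  { apply rectangle_bisection; [lra|lra| |].
    - intros a b c d Hab Hcd (p1 & K1 & H1) (p2 & K2 & H2) (p3 & K3 & H3) (p4 & K4 & H4).
      assert (Hmax : exists p, K p /\ g p1 <= g p /\ g p2 <= g p /\ g p3 <= g p /\ g p4 <= g p).
      { assert (two : forall p p', K p -> K p' -> exists r, K r /\ g p <= g r /\ g p' <= g r).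
        { intros p p' Kp Kp'. destruct (Rle_dec (g p) (g p')).
          - exists p'. repeat split; auto; lra.
          - exists p. repeat split; auto; lra. }
        destruct (two p1 p2) as (r & Kr & ? & ?); auto.
        destruct (two p3 p4) as (s & Ks & ? & ?); auto.
        destruct (two r s) as (t & Kt & ? & ?); auto.
        exists t. repeat split; auto; lra. }
      destruct Hmax as (p & Kp & G1 & G2 & G3 & G4). exists p. split; [exact Kp|].
      intros z Hz Hf Hs.
      destruct (Rle_dec (fst z) ((a + b) / 2)); destruct (Rle_dec (snd z) ((c + d) / 2)).
      + specialize (H1 z Hz). lra.
      + specialize (H3 z Hz). lra.
      + specialize (H2 z Hz). lra.
      + specialize (H4 z Hz). lra.
    - intros x y _ _. destruct (classic (K (x, y))) as [Kxy|Kxy].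
      + destruct (Hnx _ Kxy) as (p & Kp & Hp).
        destruct (Hg _ Kxy (g p - g (x, y))) as (dl & Hd & H); [lra|].
        exists (dl / 2). split; [lra|]. intros a b c d Hx Hy Hab Hcd.
        exists p. split; [exact Kp|]. intros z Hz Hf Hs.
        assert (Hzd : Cmod (z - (x, y)) < dl).
        { eapply Rle_lt_trans; [apply Cmod_le_sum|]. simpl.
          assert (Rabs (fst z + - x) < dl / 2) by (apply Rabs_def1; lra).
          assert (Rabs (snd z + - y) < dl / 2) by (apply Rabs_def1; lra). lra. }
        specialize (H z Hzd). apply Rabs_def2 in H. lra.
      + destruct (Hcl _ Kxy) as (dl & Hd & H).
        exists (dl / 2). split; [lra|]. intros a b c d Hx Hy Hab Hcd.
        exists z0. split; [exact Hz0|]. intros z Hz Hf Hs. exfalso.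
        apply (H z); [|exact Hz].
        eapply Rle_lt_trans; [apply Cmod_le_sum|]. simpl.
        assert (Rabs (fst z + - x) < dl / 2) by (apply Rabs_def1; lra).
        assert (Rabs (snd z + - y) < dl / 2) by (apply Rabs_def1; lra). lra. }
  destruct HP as (p & Kp & Hp).
  pose proof (HB p Kp). pose proof (Rabs_fst_le_Cmod p) as H1.
  pose proof (Rabs_snd_le_Cmod p) as H2.
  assert (Rabs (fst p) <= B) as F by lra. assert (Rabs (snd p) <= B) as S by lra.
  apply Rabs_le_between in F, S. specialize (Hp p Kp F S). lra.
Qed.

(** * Real differentiability and Goursat's lemma for rectangles *)

Definition rdiff2 (u : R -> R -> R) (al be x0 y0 : R) : Prop :=
  forall eps, 0 < eps -> exists d, 0 < d /\ forall x y,
    Rabs (x - x0) < d -> Rabs (y - y0) < d ->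
    Rabs (u x y - u x0 y0 - al * (x - x0) - be * (y - y0))
      <= eps * (Rabs (x - x0) + Rabs (y - y0)).

Lemma rdiff2_continuous_l (u : R -> R -> R) (al be x0 y0 : R) :
  rdiff2 u al be x0 y0 -> continuous (fun x => u x y0) x0.
Proof.
  intros H. destruct (H 1 Rlt_0_1) as (d & Hd & HH).
  apply continuity_pt_filterlim. intros eps He.
  assert (Hpos : 0 < eps / (2 + Rabs al)).
  { apply Rdiv_lt_0_compat; [exact He|]. pose proof (Rabs_pos al). lra. }
  exists (Rmin d (eps / (2 + Rabs al))). split; [now apply Rmin_pos|].
  intros x (_ & Hx). simpl in *. unfold Rdist in *.
  specialize (HH x y0). replace (y0 - y0) with 0 in HH by ring.
  rewrite Rabs_R0 in HH. pose proof (Rmin_l d (eps / (2 + Rabs al))).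
  pose proof (Rmin_r d (eps / (2 + Rabs al))).
  specialize (HH ltac:(lra) Hd).
  pose proof (Rabs_pos al). pose proof (Rabs_pos (x - x0)).
  assert (Hlt : Rabs (x - x0) * (2 + Rabs al) < eps).
  { replace eps with (eps / (2 + Rabs al) * (2 + Rabs al)) by (field; lra).
    apply Rmult_lt_compat_r; lra. }
  replace (u x y0 - u x0 y0)
    with (u x y0 - u x0 y0 - al * (x - x0) - be * 0 + al * (x - x0)) by ring.
  eapply Rle_lt_trans; [apply Rabs_triang|]. rewrite Rabs_mult. lra.
Qed.

Lemma rdiff2_swap (u : R -> R -> R) (al be x0 y0 : R) :
  rdiff2 u al be x0 y0 -> rdiff2 (fun y x => u x y) be al y0 x0.
Proof.
  intros H eps He. destruct (H eps He) as (d & Hd & HH). exists d.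
  split; [exact Hd|]. intros y x Hy Hx. specialize (HH x y Hx Hy).
  replace (u x y - u x0 y0 - be * (y - y0) - al * (x - x0))
    with (u x y - u x0 y0 - al * (x - x0) - be * (y - y0)) by ring. lra.
Qed.

(** Serves to compare the integrals over opposite sides of a small rectangle, where the integrands
    differ by almost a constant [k]. *)
Lemma RInt_minus_near (f g : R -> R) (k M a b : R) :
  a <= b -> ex_RInt f a b -> ex_RInt g a b ->
  (forall t, a <= t <= b -> Rabs (f t - g t - k) <= M) ->
  Rabs (RInt f a b - RInt g a b - k * (b - a)) <= M * (b - a).
Proof.
  intros Hab Hf Hg H.
  assert (Hc : ex_RInt (fun _ => k) a b) by apply ex_RInt_const.
  assert (Hm : ex_RInt (fun t => f t - g t) a b) by now apply @ex_RInt_minus.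
  replace (RInt f a b - RInt g a b - k * (b - a))
    with (RInt (fun t => f t - g t - k) a b).
  { rewrite Rmult_comm. apply abs_RInt_le_const; auto.
    now apply (ex_RInt_minus (fun t => f t - g t) (fun _ => k)). }
  rewrite (RInt_minus (fun t => f t - g t) (fun _ => k)) by assumption.
  rewrite (RInt_minus f g) by assumption. rewrite RInt_const.
  change (RInt f a b - RInt g a b - (b - a) * k
          = RInt f a b - RInt g a b - k * (b - a)). ring.
Qed.

(* The real part of the boundary integral of [-i (u + i v)] over a rectangle. *)
Definition flux (u v : R -> R -> R) (a b c d : R) : R :=
  (RInt (fun y => u b y) c d - RInt (fun y => u a y) c d)
  - (RInt (fun x => v x d) a b - RInt (fun x => v x c) a b).

(** Complex differentiability of [u + i v], with derivative [al - i be]. *)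
Definition cauchy_riemann (u v : R -> R -> R) (x y : R) : Prop :=
  exists al be, rdiff2 u al be x y /\ rdiff2 v (- be) al x y.

Lemma cauchy_riemann_ex_RInt (u v : R -> R -> R) (a b c d : R) :
  (forall x y, a <= x <= b -> c <= y <= d -> cauchy_riemann u v x y) ->
  (forall x c' d', a <= x <= b -> c <= c' -> c' <= d' -> d' <= d ->
     ex_RInt (fun y => u x y) c' d') /\
  (forall y a' b', c <= y <= d -> a <= a' -> a' <= b' -> b' <= b ->
     ex_RInt (fun x => v x y) a' b').
Proof.
  intros H. split.
  - intros x c' d' Hx H1 H2 H3. apply @ex_RInt_continuous. intros y Hy.
    rewrite Rmin_left, Rmax_right in Hy by lra.
    destruct (H x y) as (al & be & Hu & _); [lra|lra|].
    apply rdiff2_swap in Hu. exact (rdiff2_continuous_l _ _ _ _ _ Hu).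
  - intros y a' b' Hy H1 H2 H3. apply @ex_RInt_continuous. intros x Hx.
    rewrite Rmin_left, Rmax_right in Hx by lra.
    destruct (H x y) as (al & be & _ & Hv); [lra|lra|].
    exact (rdiff2_continuous_l _ _ _ _ _ Hv).
Qed.

(** The linear parts contribute the same amount [al] times the area to both differences in [flux]
    and cancel, so small rectangles have flux at most [eps] times the square of the half perimeter.
    Bisection preserves this bound: four quarters with half the half perimeter add up to exactly the
    same square. Finally [eps] is arbitrary. *)
Lemma goursat (u v : R -> R -> R) (a b c d : R) :
  a <= b -> c <= d ->
  (forall x y, a <= x <= b -> c <= y <= d -> cauchy_riemann u v x y) ->
  flux u v a b c d = 0.
Proof.
  intros Hab Hcd Hcr. destruct (cauchy_riemann_ex_RInt u v a b c d Hcr) as (Iu & Iv).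
  set (D := (b - a) + (d - c)).
  assert (Hall : forall eps, 0 < eps -> Rabs (flux u v a b c d) <= eps * (D * D)).
  { intros eps He.
    set (P := fun a' b' c' d' => a <= a' -> b' <= b -> c <= c' -> d' <= d ->
       Rabs (flux u v a' b' c' d') <=
         eps * (((b' - a') + (d' - c')) * ((b' - a') + (d' - c')))).
    assert (HP : P a b c d); [|apply HP; lra].
    apply rectangle_bisection; auto.
    - intros a' b' c' d' Ha Hc P1 P2 P3 P4 H1 H2 H3 H4. unfold P in *.
      set (m := (a' + b') / 2) in *. set (n := (c' + d') / 2) in *.
      assert (Hm : a' <= m <= b' /\ m - a' = (b' - a') / 2 /\ b' - m = (b' - a') / 2)
        by (unfold m; lra).
      assert (Hn : c' <= n <= d' /\ n - c' = (d' - c') / 2 /\ d' - n = (d' - c') / 2)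
        by (unfold n; lra).
      specialize (P1 ltac:(lra) ltac:(lra) ltac:(lra) ltac:(lra)).
      specialize (P2 ltac:(lra) ltac:(lra) ltac:(lra) ltac:(lra)).
      specialize (P3 ltac:(lra) ltac:(lra) ltac:(lra) ltac:(lra)).
      specialize (P4 ltac:(lra) ltac:(lra) ltac:(lra) ltac:(lra)).
      destruct Hm as (Hm & E1 & E2). destruct Hn as (Hn & E3 & E4).
      rewrite E1, E3 in P1. rewrite E2, E3 in P2. rewrite E1, E4 in P3.
      rewrite E2, E4 in P4.
      replace (flux u v a' b' c' d')
        with ((flux u v a' m c' n + flux u v m b' c' n)
              + (flux u v a' m n d' + flux u v m b' n d')).
      + eapply Rle_trans; [apply Rabs_triang|].
        pose proof (Rabs_triang (flux u v a' m c' n) (flux u v m b' c' n)).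
        pose proof (Rabs_triang (flux u v a' m n d') (flux u v m b' n d')). lra.
      + assert (Cu : forall x, a <= x <= b -> RInt (fun y => u x y) c' d'
                  = RInt (fun y => u x y) c' n + RInt (fun y => u x y) n d').
        { intros x Hx. symmetry. apply (RInt_Chasles (fun y => u x y)); apply Iu; lra. }
        assert (Cv : forall y, c <= y <= d -> RInt (fun x => v x y) a' b'
                  = RInt (fun x => v x y) a' m + RInt (fun x => v x y) m b').
        { intros y Hy. symmetry. apply (RInt_Chasles (fun x => v x y)); apply Iv; lra. }
        unfold flux. rewrite (Cu a'), (Cu b'), (Cv c'), (Cv d') by lra. ring.
    - intros x0 y0 Hx0 Hy0. destruct (Hcr x0 y0 Hx0 Hy0) as (al & be & Hu & Hv).
      destruct (Hu (eps / 2)) as (d1 & Hd1 & Eu); [lra|].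
      destruct (Hv (eps / 2)) as (d2 & Hd2 & Ev); [lra|].
      exists (Rmin d1 d2). split; [now apply Rmin_pos|].
      intros a' b' c' d' Hx Hy Wx Wy H1 H2 H3 H4.
      pose proof (Rmin_l d1 d2). pose proof (Rmin_r d1 d2).
      set (E := (b' - a') + (d' - c')).
      assert (Bnd : forall x y, a' <= x <= b' -> c' <= y <= d' ->
        Rabs (u x y - u x0 y0 - al * (x - x0) - be * (y - y0)) <= eps / 2 * E /\
        Rabs (v x y - v x0 y0 - - be * (x - x0) - al * (y - y0)) <= eps / 2 * E).
      { intros x y Hx' Hy'.
        assert (A1 : Rabs (x - x0) <= b' - a') by (apply Rabs_le; lra).
        assert (A2 : Rabs (y - y0) <= d' - c') by (apply Rabs_le; lra).
        specialize (Eu x y ltac:(lra) ltac:(lra)).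
        specialize (Ev x y ltac:(lra) ltac:(lra)).
        assert (eps / 2 * (Rabs (x - x0) + Rabs (y - y0)) <= eps / 2 * E)
          by (apply Rmult_le_compat_l; unfold E; lra).
        lra. }
      assert (Ju : Rabs (RInt (fun y => u b' y) c' d' - RInt (fun y => u a' y) c' d'
                     - (al * (b' - a')) * (d' - c')) <= eps * E * (d' - c')).
      { apply RInt_minus_near; [lra | apply Iu; lra | apply Iu; lra |].
        intros y Hy'. destruct (Bnd b' y ltac:(lra) Hy') as (B1 & _).
        destruct (Bnd a' y ltac:(lra) Hy') as (B2 & _).
        apply Rabs_le_between in B1, B2. apply Rabs_le. lra. }
      assert (Jv : Rabs (RInt (fun x => v x d') a' b' - RInt (fun x => v x c') a' b'
                     - (al * (d' - c')) * (b' - a')) <= eps * E * (b' - a')).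
      { apply RInt_minus_near; [lra | apply Iv; lra | apply Iv; lra |].
        intros x Hx'. destruct (Bnd x d' Hx' ltac:(lra)) as (_ & B1).
        destruct (Bnd x c' Hx' ltac:(lra)) as (_ & B2).
        apply Rabs_le_between in B1, B2. apply Rabs_le. lra. }
      unfold flux. apply Rabs_le_between in Ju, Jv. apply Rabs_le.
      fold E. replace (eps * (E * E)) with (eps * E * (b' - a') + eps * E * (d' - c'))
        by (unfold E; ring). lra. }
  apply NNPP. intros Hne. pose proof (Rabs_pos_lt _ Hne) as Hpos.
  assert (HD : 0 < 1 + D * D) by (pose proof (Rle_0_sqr D) as S; unfold Rsqr in S; lra).
  specialize (Hall (Rabs (flux u v a b c d) / (2 * (1 + D * D)))).
  assert (H0 : 0 < Rabs (flux u v a b c d) / (2 * (1 + D * D)))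
    by (apply Rdiv_lt_0_compat; lra).
  specialize (Hall H0).
  assert (Rabs (flux u v a b c d) / (2 * (1 + D * D)) * (D * D)
          < Rabs (flux u v a b c d) / (2 * (1 + D * D)) * (1 + D * D))
    by (apply Rmult_lt_compat_l; lra).
  assert (Rabs (flux u v a b c d) / (2 * (1 + D * D)) * (1 + D * D)
          = Rabs (flux u v a b c d) / 2) by (field; lra).
  lra.
Qed.

(** * The maximum principle *)

Definition cexp (z : C) : C := (exp (fst z) * cos (snd z), exp (fst z) * sin (snd z)).

Lemma cexp_plus (z w : C) : cexp (z + w) = (cexp z * cexp w)%C.
Proof.
  unfold cexp, Cmult. simpl. rewrite exp_plus, cos_plus, sin_plus.
  f_equal; ring.
Qed.

Lemma Cmod_cexp (z : C) : Cmod (cexp z) = exp (fst z).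
Proof.
  unfold Cmod, cexp. simpl fst; simpl snd.
  replace ((exp (fst z) * cos (snd z)) ^ 2 + (exp (fst z) * sin (snd z)) ^ 2)
    with (exp (fst z) ^ 2 * ((sin (snd z))² + (cos (snd z))²))
    by (unfold Rsqr; ring).
  rewrite sin2_cos2, Rmult_1_r. apply sqrt_pow2. left; apply exp_pos.
Qed.

Lemma derivable_pt_lim_0_le (f : R -> R) (l eps : R) :
  derivable_pt_lim f 0 l -> 0 < eps -> exists d, 0 < d /\
    forall h, Rabs h < d -> Rabs (f h - f 0 - l * h) <= eps * Rabs h.
Proof.
  intros H He. destruct (H eps He) as (d & Hd). exists d.
  split; [apply cond_pos|]. intros h Hh.
  destruct (Req_dec h 0) as [->|Hn].
  - replace (f 0 - f 0 - l * 0) with 0 by ring. rewrite Rabs_R0. lra.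
  - specialize (Hd h Hn Hh). rewrite Rplus_0_l in Hd.
    replace (f h - f 0 - l * h) with (((f h - f 0) / h - l) * h) by (now field).
    rewrite Rabs_mult. apply Rmult_le_compat_r; [apply Rabs_pos | lra].
Qed.

Lemma cexp_near_0 (eps : R) :
  0 < eps -> exists d, 0 < d /\
    forall h, Cmod h < d -> Cmod (cexp h - 1 - h) <= eps * Cmod h.
Proof.
  (* The real part will cost [3 eta |h|] and the imaginary part [4 eta |h|], together less than
     [eps |h|]. *)
  intros He. set (eta := Rmin 1 (eps / 8)).
  assert (Heta : 0 < eta) by (apply Rmin_pos; lra).
  assert (H1 : eta <= 1) by apply Rmin_l.
  assert (H8 : eta <= eps / 8) by apply Rmin_r.
  destruct (derivable_pt_lim_0_le exp 1 eta derivable_pt_lim_exp_0 Heta)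
    as (d1 & Hd1 & E1).
  destruct (derivable_pt_lim_0_le sin 1 eta derivable_pt_lim_sin_0 Heta)
    as (d2 & Hd2 & E2).
  destruct (derivable_pt_lim_0_le cos 0 eta derivable_pt_lim_cos_0 Heta)
    as (d3 & Hd3 & E3).
  set (d := Rmin (Rmin d1 d2) (Rmin d3 (Rmin eta (1 / 2)))).
  exists d. split; [repeat apply Rmin_pos; lra|].
  intros [x y] Hh. pose proof (Rabs_fst_le_Cmod (x, y)) as Hx.
  pose proof (Rabs_snd_le_Cmod (x, y)) as Hy. simpl fst in Hx; simpl snd in Hy.
  set (m := Cmod (x, y)) in *.
  assert (Hm : m < d1 /\ m < d2 /\ m < d3 /\ m < eta /\ m < 1 / 2).
  { pose proof (Rmin_l (Rmin d1 d2) (Rmin d3 (Rmin eta (1 / 2)))).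
    pose proof (Rmin_r (Rmin d1 d2) (Rmin d3 (Rmin eta (1 / 2)))).
    pose proof (Rmin_l d1 d2). pose proof (Rmin_r d1 d2).
    pose proof (Rmin_l d3 (Rmin eta (1 / 2))). pose proof (Rmin_r d3 (Rmin eta (1 / 2))).
    pose proof (Rmin_l eta (1 / 2)). pose proof (Rmin_r eta (1 / 2)).
    unfold d in Hh. lra. }
  destruct Hm as (M1 & M2 & M3 & M4 & M5).
  specialize (E1 x ltac:(lra)). specialize (E2 y ltac:(lra)).
  specialize (E3 y ltac:(lra)).
  rewrite exp_0 in E1. rewrite sin_0 in E2. rewrite cos_0 in E3.
  pose proof (Rabs_pos x) as Px. pose proof (Rabs_pos y) as Py.
  assert (Em : eta * Rabs x <= eta * m /\ eta * Rabs y <= eta * m /\ eta * m <= m /\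
               Rabs x * Rabs y <= eta * m).
  { repeat split.
    - apply Rmult_le_compat_l; lra.
    - apply Rmult_le_compat_l; lra.
    - replace m with (1 * m) at 2 by ring. apply Rmult_le_compat_r; lra.
    - apply Rmult_le_compat; lra. }
  destruct Em as (Em1 & Em2 & Em3 & Em4).
  assert (Hex : Rabs (exp x - 1) <= 2 * Rabs x).
  { replace (exp x - 1) with ((exp x - 1 - 1 * x) + x) by ring.
    eapply Rle_trans; [apply Rabs_triang|].
    assert (eta * Rabs x <= 1 * Rabs x) by (apply Rmult_le_compat_r; lra). lra. }
  assert (He2 : Rabs (exp x) <= 2).
  { replace (exp x) with ((exp x - 1) + 1) by ring.
    eapply Rle_trans; [apply Rabs_triang|]. rewrite Rabs_R1. lra. }
  assert (Hre : Rabs (exp x * cos y - 1 - x) <= 3 * (eta * m)).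
  { replace (exp x * cos y - 1 - x)
      with ((exp x - 1 - 1 * x) + exp x * (cos y - 1 - 0 * y)) by ring.
    eapply Rle_trans; [apply Rabs_triang|]. rewrite Rabs_mult.
    assert (Rabs (exp x) * Rabs (cos y - 1 - 0 * y) <= 2 * (eta * m)).
    { apply Rmult_le_compat; try apply Rabs_pos; lra. }
    lra. }
  assert (Him : Rabs (exp x * sin y - y) <= 4 * (eta * m)).
  { replace (exp x * sin y - y)
      with (exp x * (sin y - 0 - 1 * y) + (exp x - 1) * y) by ring.
    eapply Rle_trans; [apply Rabs_triang|]. rewrite !Rabs_mult.
    assert (Rabs (exp x) * Rabs (sin y - 0 - 1 * y) <= 2 * (eta * m)).
    { apply Rmult_le_compat; try apply Rabs_pos; lra. }
    assert (Rabs (exp x - 1) * Rabs y <= 2 * Rabs x * Rabs y)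
      by (apply Rmult_le_compat_r; lra).
    lra. }
  eapply Rle_trans; [apply Cmod_le_sum|]. unfold cexp. simpl.
  replace (exp x * cos y + - (1) + - x) with (exp x * cos y - 1 - x) by ring.
  replace (exp x * sin y + - 0 + - y) with (exp x * sin y - y) by ring.
  assert (eta * m <= eps / 8 * m) by (apply Rmult_le_compat_r; lra). nra.
Qed.

(** The functional equation [cexp z = cexp a * cexp (z - a)] carries the expansion at 0 to [a]. *)
Lemma cexp_cdiff (a : C) : cdiff cexp a.
Proof.
  exists (fun z => if Ceq_dec z a then cexp a else ((cexp z - cexp a) / (z - a))%C), 1.
  split; [lra|]. split.
  - intros eps He.
    assert (Hpos : 0 < Cmod (cexp a)) by (rewrite Cmod_cexp; apply exp_pos).
    destruct (cexp_near_0 (eps / 2 / Cmod (cexp a))) as (d & Hd & H).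
    { apply Rdiv_lt_0_compat; lra. }
    exists d. split; [exact Hd|]. intros z Hz.
    destruct (Ceq_dec a a) as [_|]; [|easy].
    destruct (Ceq_dec z a) as [E|N]. { rewrite Cmod_self_minus; lra. }
    assert (Nz : (z - a)%C <> 0) by (intros E; apply N; now apply Ceq_minus).
    pose proof (proj1 (Cmod_gt_0 _) Nz) as Pz.
    specialize (H (z - a)%C Hz).
    assert (Ez : cexp z = (cexp a * cexp (z - a))%C).
    { rewrite <- cexp_plus. f_equal. ring. }
    rewrite Ez.
    replace ((cexp a * cexp (z - a) - cexp a) / (z - a) - cexp a)%C
      with (cexp a * ((cexp (z - a) - 1 - (z - a)) / (z - a)))%C by (field; exact Nz).
    rewrite Cmod_mult, Cmod_div by exact Nz.
    apply Rle_lt_trans with (eps / 2); [|lra].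
    apply Rmult_le_reg_r with (Cmod (z - a)); [exact Pz|].
    replace (Cmod (cexp a) * (Cmod (cexp (z - a) - 1 - (z - a)) / Cmod (z - a))
               * Cmod (z - a))
      with (Cmod (cexp a) * Cmod (cexp (z - a) - 1 - (z - a))) by (field; lra).
    replace (eps / 2 * Cmod (z - a))
      with (Cmod (cexp a) * (eps / 2 / Cmod (cexp a) * Cmod (z - a))) by (field; lra).
    apply Rmult_le_compat_l; lra.
  - intros z _. destruct (Ceq_dec z a) as [->|N].
    + ring.
    + field. intros E. apply N. now apply Ceq_minus.
Qed.

Lemma cdiff_cauchy_riemann (f : C -> C) (x y : R) :
  cdiff f (x, y) ->
  cauchy_riemann (fun s t => fst (f (s, t))) (fun s t => snd (f (s, t))) x y.
Proof.
  intros (phi & r & Hr & Hphi & E). set (l := phi (x, y)).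
  assert (Happ : forall eps, 0 < eps -> exists d, 0 < d /\ forall s t,
     Rabs (s - x) < d -> Rabs (t - y) < d ->
     Cmod (f (s, t) - f (x, y) - l * ((s, t) - (x, y)))
       <= eps * (Rabs (s - x) + Rabs (t - y))).
  { intros eps He. destruct (Hphi eps He) as (d & Hd & H).
    exists (Rmin d r / 2). pose proof (Rmin_pos d r Hd Hr). split; [lra|].
    pose proof (Rmin_l d r). pose proof (Rmin_r d r).
    intros s t Hs Ht.
    assert (Hc : Cmod ((s, t) - (x, y)) <= Rabs (s - x) + Rabs (t - y))
      by apply (Cmod_le_sum ((s, t) - (x, y))%C).
    rewrite (E (s, t)) by lra.
    replace (phi (s, t) * ((s, t) - (x, y)) - l * ((s, t) - (x, y)))%C
      with ((phi (s, t) - l) * ((s, t) - (x, y)))%C by ring.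
    rewrite Cmod_mult. apply Rmult_le_compat; try apply Cmod_ge_0; [|exact Hc].
    left. apply H. lra. }
  exists (fst l), (- snd l). split; intros eps He;
    destruct (Happ eps He) as (d & Hd & H); exists d; (split; [exact Hd|]);
    intros s t Hs Ht; specialize (H s t Hs Ht); (eapply Rle_trans; [|exact H]).
  - eapply Rle_trans; [|apply Rabs_fst_le_Cmod]. right. f_equal. simpl. ring.
  - eapply Rle_trans; [|apply Rabs_snd_le_Cmod]. right. f_equal. simpl. ring.
Qed.

(* The mean value property: [f (a + exp (s + i t))] has period [2 i PI], so its
   mean over vertical segments does not depend on [s], and it tends to [f a] as
   [s] tends to [-oo]. *)
Lemma Re_circle_not_lt (f : C -> C) (a : C) (r eta : R) :
  0 < r -> 0 < eta -> ccont f a ->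
  (forall z, 0 < Cmod (z - a) <= r -> cdiff f z) ->
  ~ (forall z, Cmod (z - a) = r -> fst (f z) <= fst (f a) - eta).
Proof.
  intros Hr He Hc Hd Hlt.
  destruct (Hc (eta / 2)) as (d & Hd0 & H); [lra|].
  (* The circle of radius [exp s0] is so small that by continuity the real part of [f] exceeds
     [fst (f a) - eta / 2] on it. *)
  set (s0 := Rmin (ln r) (ln d) - 1).
  assert (Hs0 : s0 <= ln r) by (unfold s0; pose proof (Rmin_l (ln r) (ln d)); lra).
  assert (Hsd : exp s0 < d).
  { rewrite <- (exp_ln d) by exact Hd0. apply exp_increasing.
    unfold s0. pose proof (Rmin_r (ln r) (ln d)). lra. }
  set (F := fun z => f (a + cexp z)%C).
  assert (Hmod : forall z, Cmod (a + cexp z - a) = exp (fst z)).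
  { intros z. replace (a + cexp z - a)%C with (cexp z) by ring. apply Cmod_cexp. }
  assert (Hpi : 0 < 2 * PI) by (pose proof PI_RGT_0; lra).
  assert (Hcr : forall x y, s0 <= x <= ln r -> 0 <= y <= 2 * PI ->
     cauchy_riemann (fun s t => fst (F (s, t))) (fun s t => snd (F (s, t))) x y).
  { intros x y Hx _. apply cdiff_cauchy_riemann. unfold F. apply cdiff_comp.
    - apply cdiff_plus; [apply cdiff_const | apply cexp_cdiff].
    - apply Hd. rewrite Hmod. simpl. split; [apply exp_pos|].
      rewrite <- (exp_ln r) by exact Hr. destruct (Rle_lt_or_eq_dec x (ln r)) as [?| ->];
        [lra | left; now apply exp_increasing | lra]. }
  pose proof (goursat _ _ s0 (ln r) 0 (2 * PI) Hs0 ltac:(lra) Hcr) as G.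
  destruct (cauchy_riemann_ex_RInt _ _ _ _ _ _ Hcr) as (Iu & _).
  unfold flux in G.
  rewrite (RInt_ext (fun x => snd (F (x, 2 * PI))) (fun x => snd (F (x, 0)))) in G.
  2:{ intros x _. unfold F, cexp. simpl. now rewrite cos_2PI, sin_2PI, cos_0, sin_0. }
  assert (U1 : RInt (fun y => fst (F (ln r, y))) 0 (2 * PI)
               <= 2 * PI * (fst (f a) - eta)).
  { replace (2 * PI * (fst (f a) - eta))
      with (RInt (fun _ => fst (f a) - eta) 0 (2 * PI)).
    - apply RInt_le; [lra | apply Iu; lra | apply ex_RInt_const |].
      intros y _. apply Hlt. rewrite Hmod. simpl. now apply exp_ln.
    - rewrite RInt_const. change ((2 * PI - 0) * (fst (f a) - eta)
                                  = 2 * PI * (fst (f a) - eta)). ring. }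
  assert (U0 : 2 * PI * (fst (f a) - eta / 2)
               <= RInt (fun y => fst (F (s0, y))) 0 (2 * PI)).
  { replace (2 * PI * (fst (f a) - eta / 2))
      with (RInt (fun _ => fst (f a) - eta / 2) 0 (2 * PI)).
    - apply RInt_le; [lra | apply ex_RInt_const | apply Iu; lra |].
      intros y _. specialize (H (a + cexp (s0, y))%C).
      rewrite Hmod in H. specialize (H Hsd).
      pose proof (Rabs_fst_le_Cmod (f (a + cexp (s0, y)) - f a)%C) as Hf.
      simpl in Hf. assert (Hf' : Rabs (fst (f (a + cexp (s0, y))%C) + - fst (f a)) <= eta / 2)
        by lra.
      apply Rabs_le_between in Hf'. unfold F. lra.
    - rewrite RInt_const. change ((2 * PI - 0) * (fst (f a) - eta / 2)
                                  = 2 * PI * (fst (f a) - eta / 2)). ring. }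
  assert (2 * PI * (fst (f a) - eta) < 2 * PI * (fst (f a) - eta / 2))
    by (apply Rmult_lt_compat_l; lra).
  lra.
Qed.

Lemma ccont_rcont_fst (f : C -> C) (a : C) :
  ccont f a -> rcont (fun z => fst (f z)) a.
Proof.
  intros H eps He. destruct (H eps He) as (d & Hd & H'). exists d.
  split; [exact Hd|]. intros z Hz. specialize (H' z Hz).
  eapply Rle_lt_trans; [|exact H']. apply (Rabs_fst_le_Cmod (f z - f a)%C).
Qed.

Lemma ccont_conj (a : C) : ccont Cconj a.
Proof.
  intros eps He. exists eps. split; [exact He|]. intros z Hz.
  rewrite <- Cmod_conj in Hz.
  replace (Cconj z - Cconj a)%C with (Cconj (z - a)); [exact Hz|].
  unfold Cconj, Cminus, Cplus, Copp; simpl. f_equal; ring.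
Qed.

Lemma Cmod_sqr (z : C) : Cmod z * Cmod z = fst z * fst z + snd z * snd z.
Proof.
  replace (Cmod z * Cmod z) with (Cmod z ^ 2) by ring. rewrite Cmod2_alt.
  unfold Re, Im. ring.
Qed.

(** The centre is excluded in order to admit removable singularities; the curves [a + exp (s + i t)]
    never meet it. *)
Definition interior_cdiff (K : C -> Prop) (f : C -> C) (a : C) : Prop :=
  exists r, 0 < r /\ (forall z, Cmod (z - a) <= r -> K z) /\
    forall z, 0 < Cmod (z - a) <= r -> cdiff f z.

(* Adding [eps |z|^2] rules out interior maxima [a]: on a circle about [a] this
   term exceeds the real part of an affine function agreeing with it at [a] by a
   positive constant. *)
Lemma max_principle_Re (K : C -> Prop) (f : C -> C) (B M : R) :
  cclosed K -> (forall z, K z -> Cmod z <= M) -> (forall z, K z -> ccont f z) ->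
  (forall a, K a -> fst (f a) <= B \/ interior_cdiff K f a) ->
  forall p, K p -> fst (f p) <= B.
Proof.
  intros Hcl HM Hc Hor p Kp.
  assert (Hall : forall eps, 0 < eps -> fst (f p) <= B + eps * (M * M)).
  { intros eps He.
    assert (Hg : forall z, fst (f z + RtoC eps * (z * Cconj z))%C
                 = fst (f z) + eps * (fst z * fst z + snd z * snd z)).
    { intros z. unfold Cconj. simpl. ring. }
    destruct (compact_max K (fun z => fst (f z + RtoC eps * (z * Cconj z))%C) M)
      as (a & Ka & Ha); auto.
    { now exists p. }
    { intros z Kz. apply (ccont_rcont_fst (fun z => f z + RtoC eps * (z * Cconj z))%C).
      apply ccont_plus; [now apply Hc|]. apply ccont_mult; [apply ccont_const|].
      apply ccont_mult; [apply ccont_id | apply ccont_conj]. }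
    destruct (Hor a Ka) as [Hle|(r & Hr & HK & Hd)].
    - specialize (Ha p Kp). rewrite !Hg in Ha.
      rewrite <- !Cmod_sqr in Ha.
      assert (eps * (Cmod a * Cmod a) <= eps * (M * M)).
      { apply Rmult_le_compat_l; [lra|]. specialize (HM a Ka).
        apply Rmult_le_compat; try apply Cmod_ge_0; assumption. }
      assert (0 <= eps * (Cmod p * Cmod p)).
      { apply Rmult_le_pos; [lra|]. apply Rmult_le_pos; apply Cmod_ge_0. }
      lra.
    - exfalso.
      (* Since [|z|^2 = |z - a|^2 + 2 Re (conj a z) - |a|^2], maximality at [a] says that on the
         circle of radius [r] the real part of [h] is at most its value at [a] minus [eps r^2]. *)
      set (h := fun z => (f z + RtoC (2 * eps) * Cconj a * z)%C).
      apply (Re_circle_not_lt h a r (eps * (r * r))); auto.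
      + repeat apply Rmult_lt_0_compat; lra.
      + apply ccont_plus; [now apply Hc|]. apply ccont_mult; [apply ccont_const|].
        apply ccont_id.
      + intros z Hz. apply cdiff_plus; [now apply Hd|].
        apply cdiff_mult; [apply cdiff_const | apply cdiff_id].
      + intros z Hz. specialize (Ha z (HK z (Req_le _ _ Hz))). rewrite !Hg in Ha.
        pose proof (Cmod_sqr (z - a)%C) as Hs. rewrite Hz in Hs. simpl in Hs.
        unfold h, Cconj. simpl. rewrite Hs. lra. }
  apply Rnot_lt_le. intros Hlt.
  assert (HMM : 0 <= M * M) by (pose proof (Rle_0_sqr M) as S; exact S).
  specialize (Hall ((fst (f p) - B) / (1 + M * M)) ltac:(apply Rdiv_lt_0_compat; lra)).
  assert ((fst (f p) - B) / (1 + M * M) * (M * M)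
          < (fst (f p) - B) / (1 + M * M) * (1 + M * M)).
  { apply Rmult_lt_compat_l; [apply Rdiv_lt_0_compat; lra | lra]. }
  assert ((fst (f p) - B) / (1 + M * M) * (1 + M * M) = fst (f p) - B) by (field; lra).
  lra.
Qed.

(** Multiplication by the unimodular constant [c] that turns [f p] into its modulus reduces the
    claim to real parts. *)
Lemma max_principle (K : C -> Prop) (f : C -> C) (B M : R) :
  0 <= B -> cclosed K -> (forall z, K z -> Cmod z <= M) ->
  (forall z, K z -> ccont f z) ->
  (forall a, K a -> Cmod (f a) <= B \/ interior_cdiff K f a) ->
  forall p, K p -> Cmod (f p) <= B.
Proof.
  intros HB Hcl HM Hc Hor p Kp.
  destruct (Ceq_dec (f p) 0) as [E|N]. { rewrite E, Cmod_0. exact HB. }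
  pose proof (proj1 (Cmod_gt_0 _) N) as Pp.
  set (c := (Cconj (f p) / RtoC (Cmod (f p)))%C).
  assert (Nc : RtoC (Cmod (f p)) <> 0).
  { apply Cmod_gt_0. rewrite Cmod_R, Rabs_pos_eq; lra. }
  assert (Hc1 : Cmod c = 1).
  { unfold c. rewrite Cmod_div by exact Nc.
    rewrite Cmod_conj, Cmod_R, Rabs_pos_eq by lra. field. lra. }
  replace (Cmod (f p)) with (fst (c * f p)%C).
  - apply (max_principle_Re K (fun z => c * f z)%C B M); auto.
    + intros z Kz. apply ccont_mult; [apply ccont_const | now apply Hc].
    + intros a Ka. destruct (Hor a Ka) as [H|(r & Hr & HK & Hd)].
      * left. eapply Rle_trans; [apply Rle_abs|].
        eapply Rle_trans; [apply Rabs_fst_le_Cmod|]. rewrite Cmod_mult, Hc1. lra.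
      * right. exists r. split; [exact Hr|]. split; [exact HK|].
        intros z Hz. apply cdiff_mult; [apply cdiff_const | now apply Hd].
  - replace (c * f p)%C with (RtoC (Cmod (f p))); [reflexivity|].
    unfold c. replace (Cconj (f p) / Cmod (f p) * f p)%C
      with (f p * Cconj (f p) / Cmod (f p))%C by (field; exact Nc).
    rewrite <- Cmod2_conj. rewrite RtoC_pow. field. exact Nc.
Qed.

(** * The maximum modulus *)

Lemma cclosed_and (K L : C -> Prop) :
  cclosed K -> cclosed L -> cclosed (fun z => K z /\ L z).
Proof.
  intros HK HL z Hz. destruct (classic (K z)) as [Kz|Kz].
  - destruct (HL z) as (d & Hd & H); [tauto|]. exists d. split; [exact Hd|].
    intros w Hw (_ & Lw). now apply (H w).
  - destruct (HK z Kz) as (d & Hd & H). exists d. split; [exact Hd|].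
    intros w Hw (Kw & _). now apply (H w).
Qed.

Lemma cclosed_disc (c : C) (r : R) : cclosed (fun z => Cmod (z - c) <= r).
Proof.
  intros z Hz. apply Rnot_le_lt in Hz. exists (Cmod (z - c) - r).
  split; [lra|]. intros w Hw Hle.
  pose proof (Cmod_triangle_rev (z - c) (w - c)) as T.
  replace (z - c - (w - c))%C with (z - w)%C in T by ring.
  rewrite Cmod_minus_sym in Hw. lra.
Qed.

Lemma cclosed_outside (r : R) : cclosed (fun z => r <= Cmod z).
Proof.
  intros z Hz. apply Rnot_le_lt in Hz. exists (r - Cmod z).
  split; [lra|]. intros w Hw Hle.
  pose proof (Cmod_triangle_rev w z). lra.
Qed.

Lemma Cminus_0_r (z : C) : (z - 0)%C = z.
Proof. ring. Qed.

Lemma cclosed_disc_0 (r : R) : cclosed (fun z => Cmod z <= r).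
Proof.
  intros z Hz. destruct (cclosed_disc 0 r z) as (d & Hd & H).
  - now rewrite Cminus_0_r.
  - exists d. split; [exact Hd|]. intros w Hw. specialize (H w Hw).
    now rewrite Cminus_0_r in H.
Qed.

(** The exceptional point [c] has to be either the centre of the chosen circle or outside it, whence
    the two cases and the half distance. *)
Lemma interior_disc (f : C -> C) (c a : C) (r : R) :
  Cmod (a - c) < r -> (forall z, Cmod (z - c) <= r -> z <> c -> cdiff f z) ->
  interior_cdiff (fun z => Cmod (z - c) <= r) f a.
Proof.
  intros Ha Hd. pose proof (Cmod_ge_0 (a - c)) as P.
  destruct (Ceq_dec a c) as [->|N].
  - exists r. rewrite Cmod_self_minus in Ha. split; [exact Ha|].
    split; [auto|]. intros z (H1 & H2). apply Hd; [exact H2|].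
    intros ->. rewrite Cmod_self_minus in H1. lra.
  - assert (Pa : 0 < Cmod (a - c)).
    { apply Cmod_gt_0. intros E. apply N. now apply Ceq_minus. }
    set (s := Rmin (r - Cmod (a - c)) (Cmod (a - c) / 2)).
    assert (S1 : s <= r - Cmod (a - c)) by apply Rmin_l.
    assert (S2 : s <= Cmod (a - c) / 2) by apply Rmin_r.
    assert (HK : forall z, Cmod (z - a) <= s -> Cmod (z - c) <= r).
    { intros z Hz. replace (z - c)%C with ((z - a) + (a - c))%C by ring.
      pose proof (Cmod_triangle (z - a) (a - c)). lra. }
    exists s. split; [apply Rmin_pos; lra|]. split; [exact HK|].
    intros z (H1 & H2). apply Hd; [now apply HK|].
    intros ->. rewrite Cmod_minus_sym in H2. lra.
Qed.

(* The quotient [(f z - f c) / (z - c)] is only known to be continuous at [c],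
   which suffices for the maximum principle. *)
Lemma schwarz (f : C -> C) (c : C) (r B : R) :
  0 < r -> 0 <= B -> (forall z, Cmod (z - c) <= r -> cdiff f z) ->
  (forall z, Cmod (z - c) = r -> Cmod (f z - f c) <= B) ->
  forall z, Cmod (z - c) <= r -> Cmod (f z - f c) <= B / r * Cmod (z - c).
Proof.
  intros Hr HB Hd Hle z Hz.
  assert (Hfc : cdiff f c) by (apply Hd; rewrite Cmod_self_minus; lra).
  destruct Hfc as (phi & s & Hs & Hphi & E).
  set (q := fun z => if Ceq_dec z c then phi c else ((f z - f c) / (z - c))%C).
  assert (Hne : forall w, w <> c -> (w - c)%C <> 0).
  { intros w Nw Ew. apply Nw. now apply Ceq_minus. }
  assert (Hq : forall w, w <> c -> q w = ((f w - f c) / (w - c))%C).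
  { intros w Nw. unfold q. now destruct (Ceq_dec w c). }
  assert (Hqd : forall w, Cmod (w - c) <= r -> w <> c -> cdiff q w).
  { intros w Hw Nw.
    apply (cdiff_ext_loc _ (fun w => (f w + - f c) * / (w + - c))%C w (Cmod (w - c))).
    - apply Cmod_gt_0. now apply Hne.
    - intros u Hu. rewrite Hq; [reflexivity|]. intros ->.
      rewrite Cmod_minus_sym in Hu. lra.
    - apply cdiff_mult.
      + apply cdiff_plus; [now apply Hd | apply cdiff_const].
      + apply cdiff_inv; [now apply Hne|].
        apply cdiff_plus; [apply cdiff_id | apply cdiff_const]. }
  assert (Hqc : forall w, Cmod (w - c) <= r -> ccont q w).
  { intros w Hw. destruct (Ceq_dec w c) as [->|Nw].
    - apply (ccont_ext_loc _ phi c s Hs); [|exact Hphi].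
      intros u Hu. unfold q. destruct (Ceq_dec u c) as [->|Nu]; [reflexivity|].
      rewrite (E u Hu). field. now apply Hne.
    - apply cdiff_ccont. now apply Hqd. }
  assert (Hqz : Cmod (q z) <= B / r).
  { apply (max_principle (fun z => Cmod (z - c) <= r) q (B / r) (Cmod c + r)); auto.
    - apply Rdiv_le_0_compat; lra.
    - apply cclosed_disc.
    - intros w Hw. pose proof (Cmod_triangle_rev w c). lra.
    - intros a Ha. destruct (Rle_lt_or_eq_dec _ _ Ha) as [Hlt|Heq].
      + right. now apply interior_disc.
      + left. assert (Na : a <> c).
        { intros ->. rewrite Cmod_self_minus in Heq. lra. }
        rewrite Hq, Cmod_div by auto. rewrite Heq.
        apply Rmult_le_compat_r; [left; now apply Rinv_0_lt_compat | now apply Hle]. }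
  destruct (Ceq_dec z c) as [->|Nz].
  - rewrite !Cmod_self_minus. lra.
  - replace (f z - f c)%C with (q z * (z - c))%C.
    + rewrite Cmod_mult. apply Rmult_le_compat_r; [apply Cmod_ge_0 | exact Hqz].
    + rewrite Hq by exact Nz. field. now apply Hne.
Qed.

Lemma entire_ccont (f : C -> C) : entire f -> forall z, ccont f z.
Proof. intros Hf z. apply cdiff_ccont. now apply entire_cdiff. Qed.

Lemma rcont_Cmod (f : C -> C) (a : C) : ccont f a -> rcont (fun z => Cmod (f z)) a.
Proof.
  intros H eps He. destruct (H eps He) as (d & Hd & H'). exists d.
  split; [exact Hd|]. intros z Hz. specialize (H' z Hz).
  pose proof (Cmod_triangle_rev (f z) (f a)).
  pose proof (Cmod_triangle_rev (f a) (f z)) as T. rewrite Cmod_minus_sym in T.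
  apply Rabs_def1; lra.
Qed.

(** Compactness of the circle, written as the intersection of two closed sets, turns the least upper
    bound into an attained maximum. All later facts on [max_modulus] rest on this. *)
Lemma max_modulus_spec (f : C -> C) (r : R) :
  entire f -> 0 <= r ->
  exists w, Cmod w = r /\ max_modulus f r = Cmod (f w) /\
    forall z, Cmod z = r -> Cmod (f z) <= Cmod (f w).
Proof.
  intros Hf Hr.
  destruct (compact_max (fun z => Cmod z <= r /\ r <= Cmod z)
              (fun z => Cmod (f z)) r) as (w & (Hw1 & Hw2) & Hw).
  - apply cclosed_and; [apply cclosed_disc_0 | apply cclosed_outside].
  - exists (RtoC r). rewrite Cmod_R, Rabs_pos_eq; lra.
  - tauto.
  - intros z _. apply rcont_Cmod. now apply entire_ccont.
  - exists w. split; [lra|].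
    assert (Hmax : forall z, Cmod z = r -> Cmod (f z) <= Cmod (f w)).
    { intros z Hz. apply Hw. lra. }
    split; [|exact Hmax].
    unfold max_modulus. rewrite (is_lub_Rbar_unique _ (Cmod (f w))); [reflexivity|].
    split.
    + intros x (z & Hz & ->). now apply Hmax.
    + intros b Hb. apply Hb. exists w. split; [lra | reflexivity].
Qed.

Lemma le_max_modulus (f : C -> C) (r : R) (z : C) :
  entire f -> Cmod z <= r -> Cmod (f z) <= max_modulus f r.
Proof.
  intros Hf Hz.
  assert (Hr : 0 <= r) by (eapply Rle_trans; [apply Cmod_ge_0 | exact Hz]).
  destruct (max_modulus_spec f r Hf Hr) as (w & Hw & -> & Hmax).
  apply (max_principle (fun z => Cmod z <= r) f (Cmod (f w)) r); auto.
  - apply Cmod_ge_0.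
  - apply cclosed_disc_0.
  - intros; now apply entire_ccont.
  - intros a Ha. destruct (Rle_lt_or_eq_dec _ _ Ha) as [Hlt|Heq].
    + right. exists (r - Cmod a). split; [lra|]. split.
      * intros u Hu. pose proof (Cmod_triangle_rev u a). lra.
      * intros u _. now apply entire_cdiff.
    + left. now apply Hmax.
Qed.

Lemma max_modulus_ge_0 (f : C -> C) (r : R) :
  entire f -> 0 <= r -> 0 <= max_modulus f r.
Proof.
  intros Hf Hr. destruct (max_modulus_spec f r Hf Hr) as (w & _ & -> & _).
  apply Cmod_ge_0.
Qed.

Lemma max_modulus_mono (f : C -> C) (r s : R) :
  entire f -> 0 <= r -> r <= s -> max_modulus f r <= max_modulus f s.
Proof.
  intros Hf Hr Hs. destruct (max_modulus_spec f r Hf Hr) as (w & Hw & -> & _).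
  apply le_max_modulus; [exact Hf | lra].
Qed.

(** Schwarz's lemma about [w] with radius [2 r]: this disc contains all [z] with [|z| <= r] and lies
    in the disc of radius [3 r] about 0. The summand 1 in the constant ensures [0 < L]. *)
Lemma entire_lipschitz_on_disc (f : C -> C) (r : R) :
  entire f -> 0 < r -> exists L, 0 < L /\
    forall z w, Cmod z <= r -> Cmod w <= r -> Cmod (f z - f w) <= L * Cmod (z - w).
Proof.
  intros Hf Hr. set (B := 2 * max_modulus f (3 * r)).
  assert (HB : 0 <= B).
  { pose proof (max_modulus_ge_0 f (3 * r) Hf ltac:(lra)). unfold B; lra. }
  exists (B / (2 * r) + 1). split.
  { pose proof (Rdiv_le_0_compat B (2 * r) HB ltac:(lra)). lra. }
  intros z w Hz Hw.
  assert (H : Cmod (f z - f w) <= B / (2 * r) * Cmod (z - w)).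
  { apply schwarz; [lra | exact HB | intros; now apply entire_cdiff | |].
    - intros u Hu. eapply Rle_trans; [apply Cmod_triangle_minus|].
      assert (Cmod (f u) <= max_modulus f (3 * r)).
      { apply le_max_modulus; [exact Hf|]. pose proof (Cmod_triangle_rev u w). lra. }
      assert (Cmod (f w) <= max_modulus f (3 * r))
        by (apply le_max_modulus; [exact Hf | lra]).
      unfold B. lra.
    - eapply Rle_trans; [apply Cmod_triangle_minus|]. lra. }
  pose proof (Cmod_ge_0 (z - w)). lra.
Qed.

(** A quantitative Liouville theorem: Schwarz's lemma at 0 bounds [|f z0 - f 0|] by
    [(M(r) + |f 0|) |z0| / r], which is solved for M(r). *)
Lemma liouville (f : C -> C) (z0 : C) :
  entire f -> f z0 <> f 0 ->
  exists c d, 0 < c /\ forall r, Cmod z0 <= r -> c * r - d <= max_modulus f r.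
Proof.
  intros Hf Hne.
  assert (Hz0 : 0 < Cmod z0) by (apply Cmod_gt_0; intros ->; now apply Hne).
  assert (Hpos : 0 < Cmod (f z0 - f 0)).
  { apply Cmod_gt_0. intros E. apply Hne. now apply Ceq_minus. }
  exists (Cmod (f z0 - f 0) / Cmod z0), (Cmod (f 0)).
  split; [now apply Rdiv_lt_0_compat|]. intros r Hr.
  pose proof (max_modulus_ge_0 f r Hf ltac:(lra)) as HM.
  assert (H : Cmod (f z0 - f 0) <= (max_modulus f r + Cmod (f 0)) / r * Cmod (z0 - 0)).
  { apply schwarz; [lra | pose proof (Cmod_ge_0 (f 0)); lra
                   | intros; now apply entire_cdiff | |].
    - intros z Hz. rewrite Cminus_0_r in Hz.
      eapply Rle_trans; [apply Cmod_triangle_minus|].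
      apply Rplus_le_compat_r. apply le_max_modulus; [exact Hf | lra].
    - rewrite Cminus_0_r. exact Hr. }
  rewrite Cminus_0_r in H.
  assert (Cmod (f z0 - f 0) / Cmod z0 * r <= max_modulus f r + Cmod (f 0)); [|lra].
  apply Rmult_le_reg_r with (Cmod z0 / r); [apply Rdiv_lt_0_compat; lra|].
  replace (Cmod (f z0 - f 0) / Cmod z0 * r * (Cmod z0 / r))
    with (Cmod (f z0 - f 0)) by (field; lra).
  replace ((max_modulus f r + Cmod (f 0)) * (Cmod z0 / r))
    with ((max_modulus f r + Cmod (f 0)) / r * Cmod z0) by (field; lra).
  exact H.
Qed.

Lemma transcendental_not_constant (f : C -> C) :
  transcendental_entire f -> exists z0, f z0 <> f 0.
Proof.
  intros (_ & Hp). apply NNPP. intros H. apply Hp. exists O, (fun _ => f 0).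
  intros z. rewrite sum_O. replace (f 0 * z ^ 0)%C with (f 0) by (simpl; ring).
  apply NNPP. intros Hz. apply H. now exists z.
Qed.

(** * Harnack's inequality and Polya's theorem *)

Lemma exp_le_compat (x y : R) : x <= y -> exp x <= exp y.
Proof. intros [H| ->]; [left; now apply exp_increasing | apply Rle_refl]. Qed.

Lemma exp_INR_mult (n : nat) (x : R) : exp (INR n * x) = exp x ^ n.
Proof.
  induction n as [|n IH]; [simpl; now rewrite Rmult_0_l, exp_0|].
  rewrite S_INR, Rmult_plus_distr_r, Rmult_1_l, exp_plus, IH. simpl. ring.
Qed.

Lemma pow_S_lt_compat (a b : R) (n : nat) : 0 <= a < b -> a ^ S n < b ^ S n.
Proof.
  intros H. simpl. pose proof (pow_incr a b n ltac:(lra)).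
  assert (0 < b ^ n) by (apply pow_lt; lra).
  apply Rle_lt_trans with (a * b ^ n).
  - apply Rmult_le_compat_l; lra.
  - apply Rmult_lt_compat_r; lra.
Qed.

(** The Moebius map [u / (u + 2 a)] fixes 0 and sends the half plane [Re u >= - a] into the unit
    disc. By Schwarz's lemma its composition with [h] is at most 1/3 on the smaller disc, and
    [|h| <= (|h| + 2 a) / 3] gives [|h| <= a]. *)
Lemma borel_caratheodory (h : C -> C) (r a : R) :
  0 < r -> 0 < a -> h 0 = 0 -> (forall z, Cmod z <= r -> cdiff h z) ->
  (forall z, Cmod z <= r -> - a <= fst (h z)) ->
  forall z, Cmod z <= r / 3 -> Cmod (h z) <= a.
Proof.
  intros Hr Ha H0 Hd Hre z Hz.
  set (k := RtoC (2 * a)).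
  assert (Hk : Cmod k = 2 * a) by (unfold k; rewrite Cmod_R; apply Rabs_pos_eq; lra).
  assert (Hne : forall w, Cmod w <= r -> (h w + k)%C <> 0).
  { intros w Hw E. specialize (Hre w Hw). apply (f_equal fst) in E.
    simpl in E. lra. }
  assert (Hle : forall w, Cmod w <= r -> Cmod (h w) <= Cmod (h w + k)).
  { intros w Hw. specialize (Hre w Hw).
    apply Rsqr_incr_0_var; [|apply Cmod_ge_0]. unfold Rsqr.
    rewrite !Cmod_sqr. simpl. nra. }
  set (q := fun w => (h w * / (h w + k))%C).
  assert (Hq0 : q 0 = 0) by (unfold q; rewrite H0; ring).
  assert (Hqz : Cmod (q z) <= 1 / 3).
  { replace (q z) with (q z - q 0)%C by (rewrite Hq0; ring).
    apply Rle_trans with (1 / r * Cmod (z - 0)).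
    - apply schwarz; [lra | lra | | | rewrite Cminus_0_r; lra].
      + intros w Hw. rewrite Cminus_0_r in Hw. apply cdiff_mult; [now apply Hd|].
        apply cdiff_inv; [now apply Hne|].
        apply cdiff_plus; [now apply Hd | apply cdiff_const].
      + intros w Hw. rewrite Cminus_0_r in Hw. rewrite Hq0, Cminus_0_r.
        unfold q. rewrite Cmod_mult, Cmod_inv by (apply Hne; lra).
        assert (P : 0 < Cmod (h w + k)) by (apply Cmod_gt_0, Hne; lra).
        apply Rmult_le_reg_r with (Cmod (h w + k)); [exact P|].
        rewrite Rmult_assoc, Rinv_l, Rmult_1_r, Rmult_1_l by lra. apply Hle; lra.
    - rewrite Cminus_0_r.
      replace (1 / 3) with (1 / r * (r / 3)) by (field; lra).
      apply Rmult_le_compat_l; [|exact Hz].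
      apply Rdiv_le_0_compat; lra. }
  assert (E : h z = (q z * (h z + k))%C).
  { unfold q. field. apply Hne. lra. }
  pose proof (Cmod_triangle (h z) k) as T. rewrite Hk in T.
  assert (Cmod (h z) <= 1 / 3 * Cmod (h z + k)).
  { rewrite E at 1. rewrite Cmod_mult. apply Rmult_le_compat_r; [apply Cmod_ge_0|].
    exact Hqz. }
  lra.
Qed.

Lemma ln_le_minus_1 (x : R) : 0 < x -> ln x <= x - 1.
Proof.
  intros Hx. pose proof (exp_ineq1_le (ln x)) as H. rewrite exp_ln in H by exact Hx. lra.
Qed.

(** This is [ln s <= s - 1] at [s = |1 + x|^2 = 1 + 2 Re x + |x|^2]; it replaces the expansion of a
    complex logarithm. *)
Lemma ln_Cmod_1_plus (x : C) :
  (1 + x)%C <> 0 -> ln (Cmod (1 + x)) <= fst x + Cmod x * Cmod x / 2.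
Proof.
  intros Hx. apply Cmod_gt_0 in Hx.
  pose proof (ln_le_minus_1 _ (Rmult_lt_0_compat _ _ Hx Hx)) as H.
  rewrite ln_mult in H by assumption.
  rewrite Cmod_sqr in H. rewrite Cmod_sqr. simpl in H. lra.
Qed.

Fixpoint csum (f : nat -> C) (n : nat) : C :=
  match n with O => RtoC 0 | S n => (csum f n + f n)%C end.

Lemma cdiff_csum (f : nat -> C -> C) (n : nat) (a : C) :
  (forall i, (i < n)%nat -> cdiff (f i) a) ->
  cdiff (fun z => csum (fun i => f i z) n) a.
Proof.
  intros H. induction n as [|n IH]; simpl; [apply cdiff_const|].
  apply cdiff_plus; [apply IH; intros i Hi | ]; apply H; lia.
Qed.

Lemma csum_0 (f : nat -> C) (n : nat) :
  (forall i, (i < n)%nat -> f i = 0) -> csum f n = 0.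
Proof.
  intros H. induction n as [|n IH]; simpl; [reflexivity|].
  rewrite IH, H by (lia || intros; apply H; lia). ring.
Qed.

(* An analytic logarithm of [P] is replaced by the sums over [j < m] of
   [P (z (j+1) / m) / P (z j / m) - 1], whose real parts tend to
   [ln |P z / P 0|] as [m] tends to infinity. *)
Lemma harnack_nonvanishing (P : C -> C) (r a : R) :
  entire P -> 0 < r -> 0 <= a -> P 0 <> 0 ->
  (forall z, Cmod z <= r -> exp (- a) * Cmod (P 0) <= Cmod (P z)) ->
  forall z, Cmod z <= r / 3 -> Cmod (P z) <= exp a * Cmod (P 0).
Proof.
  intros HP Hr Ha H0 Hlow z Hz.
  apply Cmod_gt_0 in H0.
  set (pm := exp (- a) * Cmod (P 0)) in *.
  assert (Hpm : 0 < pm) by (apply Rmult_lt_0_compat; [apply exp_pos | exact H0]).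
  assert (Hne : forall w, Cmod w <= r -> P w <> 0).
  { intros w Hw. apply Cmod_gt_0. specialize (Hlow w Hw). lra. }
  destruct (entire_lipschitz_on_disc P r HP Hr) as (L & HL & Lip).
  (* Between consecutive points [P] changes by at most [L r / m], and [|P|] is at least [pm]; hence
     each quotient differs from 1 by at most [K / m]. *)
  set (K := L * r / pm).
  assert (HK : 0 < K) by (apply Rdiv_lt_0_compat; [now apply Rmult_lt_0_compat | exact Hpm]).
  assert (Happ : forall m, (0 < m)%nat ->
            ln (Cmod (P z)) - ln (Cmod (P 0)) <= a + K * K / INR m).
  { intros m Hm. assert (Pm : 0 < INR m) by (apply lt_0_INR; exact Hm).
    set (pt := fun (j : nat) (w : C) => (RtoC (INR j / INR m) * w)%C).
    set (x := fun (j : nat) (w : C) => (P (pt (S j) w) * / P (pt j w) + - RtoC 1)%C).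
    set (h := fun w => csum (fun j => x j w) m).
    assert (Hpt : forall j w, (j <= m)%nat -> Cmod w <= r -> Cmod (pt j w) <= r).
    { intros j w Hj Hw. unfold pt. rewrite Cmod_mult, Cmod_R.
      assert (0 <= INR j / INR m <= 1).
      { split; [apply Rdiv_le_0_compat; [apply pos_INR | exact Pm]|].
        apply Rmult_le_reg_r with (INR m); [exact Pm|].
        unfold Rdiv. rewrite Rmult_assoc, Rinv_l, Rmult_1_r, Rmult_1_l by lra.
        now apply le_INR. }
      rewrite Rabs_pos_eq by lra. pose proof (Cmod_ge_0 w). nra. }
    assert (Hx : forall j w, (j < m)%nat -> Cmod w <= r -> Cmod (x j w) <= K / INR m).
    { intros j w Hj Hw.
      assert (N0 := Hne _ (Hpt j w ltac:(lia) Hw)).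
      replace (x j w) with ((P (pt (S j) w) - P (pt j w)) / P (pt j w))%C
        by (unfold x; field; exact N0).
      rewrite Cmod_div by exact N0.
      pose proof (Hlow _ (Hpt j w ltac:(lia) Hw)) as HL1.
      assert (HL2 := Lip (pt (S j) w) (pt j w) (Hpt _ w Hj Hw) (Hpt j w ltac:(lia) Hw)).
      replace (pt (S j) w - pt j w)%C with (RtoC (/ INR m) * w)%C in HL2.
      2:{ unfold pt. rewrite S_INR.
          replace ((INR j + 1) / INR m) with (INR j / INR m + / INR m) by (field; lra).
          rewrite RtoC_plus. ring. }
      rewrite Cmod_mult, Cmod_R, Rabs_pos_eq in HL2
        by (left; now apply Rinv_0_lt_compat).
      unfold K. replace (L * r / pm / INR m) with (L * (/ INR m * r) * / pm)
        by (field; lra).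
      apply Rmult_le_compat; [apply Cmod_ge_0 | left; apply Rinv_0_lt_compat; lra | |].
      - eapply Rle_trans; [exact HL2|]. apply Rmult_le_compat_l; [lra|].
        apply Rmult_le_compat_l; [left; now apply Rinv_0_lt_compat | exact Hw].
      - now apply Rinv_le_contravar. }
    (* The [m] quadratic errors [(K / m)^2 / 2] add up to [e]. It is paid twice: in the lower bound
       for the real part of [h], and in the return from [h z] to [P z]. *)
    set (e := K * K / (2 * INR m)).
    assert (He : 0 < e) by (apply Rdiv_lt_0_compat; [now apply Rmult_lt_0_compat | lra]).
    assert (Hstep : forall n w, (n <= m)%nat -> Cmod w <= r ->
       ln (Cmod (P (pt n w))) - ln (Cmod (P 0))
         <= fst (csum (fun j => x j w) n) + INR n * (K / INR m * (K / INR m) / 2)).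
    { intros n w Hn Hw. induction n as [|n IH].
      - replace (pt O w) with (RtoC 0); [simpl; lra|].
        unfold pt. simpl. unfold Rdiv. rewrite Rmult_0_l. ring.
      - specialize (IH ltac:(lia)).
        assert (N0 := Hne _ (Hpt n w ltac:(lia) Hw)).
        assert (N1 := Hne _ (Hpt (S n) w ltac:(lia) Hw)).
        assert (E : P (pt (S n) w) = (P (pt n w) * (1 + x n w))%C)
          by (unfold x; field; exact N0).
        assert (N2 : (1 + x n w)%C <> 0).
        { intros E'. apply N1. rewrite E, E'. ring. }
        rewrite E, Cmod_mult, ln_mult by now apply Cmod_gt_0.
        pose proof (ln_Cmod_1_plus _ N2) as Hln.
        specialize (Hx n w ltac:(lia) Hw). pose proof (Cmod_ge_0 (x n w)).
        assert (Cmod (x n w) * Cmod (x n w) <= K / INR m * (K / INR m))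
          by (apply Rmult_le_compat; assumption).
        rewrite S_INR.
        change (fst (csum (fun j => x j w) (S n)))
          with (fst (csum (fun j => x j w) n) + fst (x n w)).
        lra. }
    assert (Hend : forall w, Cmod w <= r ->
       ln (Cmod (P w)) - ln (Cmod (P 0)) <= fst (h w) + e).
    { intros w Hw. specialize (Hstep m w (Nat.le_refl m) Hw).
      replace (pt m w) with w in Hstep.
      2:{ unfold pt. replace (INR m / INR m) with 1 by (field; lra). ring. }
      replace e with (INR m * (K / INR m * (K / INR m) / 2))
        by (unfold e; field; lra). exact Hstep. }
    assert (Hh : Cmod (h z) <= a + e).
    { apply (borel_caratheodory h r); auto; [lra| | |].
      - apply csum_0. intros i _. unfold x, pt.
        rewrite !Cmult_0_r. field. apply Hne. rewrite Cmod_0. lra.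
      - intros w Hw. apply (cdiff_csum x). intros i Hi. unfold x.
        assert (Hpd : forall j, cdiff (fun w => P (pt j w)) w).
        { intros j. apply cdiff_comp; [|now apply entire_cdiff].
          apply cdiff_mult; [apply cdiff_const | apply cdiff_id]. }
        apply cdiff_plus; [|apply cdiff_const].
        apply cdiff_mult; [apply Hpd|]. apply cdiff_inv; [|apply Hpd].
        apply Hne. apply Hpt; [lia | exact Hw].
      - intros w Hw. specialize (Hend w Hw). specialize (Hlow w Hw).
        apply ln_le in Hlow; [|exact Hpm].
        unfold pm in Hlow. rewrite ln_mult, ln_exp in Hlow by (exact H0 || apply exp_pos).
        lra. }
    specialize (Hend z ltac:(lra)).
    pose proof (Rabs_fst_le_Cmod (h z)) as Hf. pose proof (Rle_abs (fst (h z))).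
    replace (K * K / INR m) with (e + e) by (unfold e; field; lra). lra. }
  assert (Hfin : ln (Cmod (P z)) - ln (Cmod (P 0)) <= a).
  { apply Rnot_lt_le. intros Hlt.
    set (g := ln (Cmod (P z)) - ln (Cmod (P 0)) - a).
    destruct (INR_unbounded (K * K / g)) as (m & Hm).
    assert (Hg : 0 < g) by (unfold g; lra).
    assert (Pm : 0 < INR m).
    { assert (0 < K * K / g); [|lra].
      apply Rdiv_lt_0_compat; [now apply Rmult_lt_0_compat | exact Hg]. }
    specialize (Happ m ltac:(apply INR_lt; exact Pm)).
    assert (K * K / INR m < g); [|unfold g in *; lra].
    apply Rmult_lt_reg_r with (INR m / g); [now apply Rdiv_lt_0_compat|].
    replace (K * K / INR m * (INR m / g)) with (K * K / g) by (field; lra).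
    replace (g * (INR m / g)) with (INR m) by (field; lra). exact Hm. }
  assert (Pz : 0 < Cmod (P z)) by (apply Cmod_gt_0, Hne; lra).
  rewrite <- (exp_ln (Cmod (P z))) by exact Pz.
  rewrite <- (exp_ln (Cmod (P 0))) by exact H0. rewrite <- exp_plus.
  apply exp_le_compat. lra.
Qed.

(** * Products of distances to equidistant points *)

Fixpoint rprod (f : nat -> R) (n : nat) : R :=
  match n with O => 1 | S n => rprod f n * f n end.

Fixpoint cprod (f : nat -> C) (n : nat) : C :=
  match n with O => RtoC 1 | S n => (cprod f n * f n)%C end.

Lemma rprod_shift (f : nat -> R) (n : nat) :
  rprod f (S n) = f O * rprod (fun i => f (S i)) n.
Proof.
  induction n as [|n IH]; [simpl; ring|].
  change (rprod f (S (S n))) with (rprod f (S n) * f (S n)). rewrite IH. simpl. ring.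
Qed.

Lemma rprod_ext (f g : nat -> R) (n : nat) :
  (forall i, f i = g i) -> rprod f n = rprod g n.
Proof. intros H. induction n as [|n IH]; simpl; [reflexivity|]. now rewrite IH, H. Qed.

Lemma rprod_le (f g : nat -> R) (n : nat) :
  (forall i, (i < n)%nat -> 0 <= f i <= g i) -> 0 <= rprod f n <= rprod g n.
Proof.
  intros H. induction n as [|n IH]; simpl; [lra|].
  destruct IH as (I1 & I2); [intros i Hi; apply H; lia|].
  destruct (H n ltac:(lia)) as (F1 & F2). split; [now apply Rmult_le_pos|].
  now apply Rmult_le_compat.
Qed.

Lemma rprod_const (c : R) (n : nat) : rprod (fun _ => c) n = c ^ n.
Proof. induction n as [|n IH]; simpl; [reflexivity|]. rewrite IH. ring. Qed.

Lemma rprod_scal (c : R) (f : nat -> R) (n : nat) :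
  rprod (fun i => c * f i) n = c ^ n * rprod f n.
Proof. induction n as [|n IH]; simpl; [ring|]. rewrite IH. ring. Qed.

Lemma Cmod_cprod (f : nat -> C) (n : nat) :
  Cmod (cprod f n) = rprod (fun i => Cmod (f i)) n.
Proof.
  induction n as [|n IH]; simpl; [apply Cmod_1|]. now rewrite Cmod_mult, IH.
Qed.

(* Induction removing whichever end of [0, ..., n + 1] is farther from [y]. *)
Lemma rprod_dist_fact (n : nat) (y d : R) :
  0 < d ->
  d * (INR (fact n) / 2 ^ n) <= rprod (fun i => Rmax (Rabs (y - INR i)) d) (S n).
Proof.
  intros Hd. revert y. induction n as [|n IH]; intros y.
  - simpl. pose proof (Rmax_r (Rabs (y - 0)) d). lra.
  - assert (Hf : forall z, 0 <= rprod (fun i => Rmax (Rabs (z - INR i)) d) (S n)).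
    { intros z. apply (rprod_le _ (fun i => Rmax (Rabs (z - INR i)) d)). intros i _.
      pose proof (Rmax_r (Rabs (z - INR i)) d). lra. }
    assert (Hfact : 0 <= d * (INR (fact n) / 2 ^ n)).
    { apply Rmult_le_pos; [lra|]. apply Rdiv_le_0_compat; [apply pos_INR|].
      apply pow_lt; lra. }
    assert (Hn : 0 <= INR (S n) / 2) by (pose proof (pos_INR (S n)); lra).
    replace (d * (INR (fact (S n)) / 2 ^ S n))
      with ((d * (INR (fact n) / 2 ^ n)) * (INR (S n) / 2)).
    2:{ rewrite fact_simpl, mult_INR. simpl pow. field.
        apply pow_nonzero. lra. }
    destruct (Rle_dec (INR (S n) / 2) y) as [Hy|Hy].
    + rewrite rprod_shift.
      rewrite (rprod_ext _ (fun i => Rmax (Rabs (y - 1 - INR i)) d)).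
      2:{ intros i. rewrite S_INR. do 2 f_equal. ring. }
      rewrite (Rmult_comm (Rmax _ _)). apply Rmult_le_compat; auto.
      eapply Rle_trans; [|apply Rmax_l]. simpl INR at 2. rewrite Rminus_0_r.
      eapply Rle_trans; [exact Hy | apply Rle_abs].
    + change (rprod (fun i => Rmax (Rabs (y - INR i)) d) (S (S n)))
        with (rprod (fun i => Rmax (Rabs (y - INR i)) d) (S n)
              * Rmax (Rabs (y - INR (S n))) d).
      apply Rmult_le_compat; auto.
      eapply Rle_trans; [|apply Rmax_l]. rewrite Rabs_minus_sym.
      eapply Rle_trans; [|apply Rle_abs]. lra.
Qed.

(** A weak Stirling bound, by induction from [(1 + 1/n)^n <= e <= 3]. *)
Lemma pow_self_le_fact (n : nat) : INR n ^ n <= 3 ^ n * INR (fact n).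
Proof.
  induction n as [|n IH]; [simpl; lra|].
  assert (H : INR (S n) ^ n <= 3 * INR n ^ n).
  { destruct n as [|n]; [simpl; lra|].
    set (x := INR (S n)) in *. assert (Hx : 0 < x) by (apply lt_0_INR; lia).
    rewrite S_INR. fold x.
    replace (x + 1) with (x * (1 + / x)) by (field; lra).
    rewrite Rpow_mult_distr, Rmult_comm. apply Rmult_le_compat_r; [apply pow_le; lra|].
    apply Rle_trans with (exp (/ x) ^ S n).
    - apply pow_incr. split; [|apply exp_ineq1_le].
      pose proof (Rinv_0_lt_compat x Hx). lra.
    - rewrite <- exp_INR_mult. fold x. rewrite Rinv_r by lra. apply exp_le_3. }
  rewrite fact_simpl, mult_INR, <- !tech_pow_Rmult.
  pose proof (pos_INR (S n)).
  replace (3 * 3 ^ n * (INR (S n) * INR (fact n)))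
    with (INR (S n) * (3 * (3 ^ n * INR (fact n)))) by ring.
  apply Rmult_le_compat_l; lra.
Qed.

(** The constant is [12 = 3 * 2 * 2]: the 3 comes from the Stirling bound, one 2 from the power of 2
    in [rprod_dist_fact], and the other pays, through [n <= 2^n], for having the factorial of
    [n - 1] instead of [n]. *)
Lemma rprod_dist_lower (n : nat) (y d : R) :
  (0 < n)%nat -> 0 < d ->
  (INR n / 12) ^ n * d <= rprod (fun i => Rmax (Rabs (y - INR i)) d) n.
Proof.
  intros Hn Hd. destruct n as [|n]; [lia|].
  eapply Rle_trans; [|apply rprod_dist_fact; exact Hd].
  rewrite Rmult_comm. apply Rmult_le_compat_l; [lra|].
  unfold Rdiv. rewrite Rpow_mult_distr, pow_inv.
  pose proof (pow_self_le_fact (S n)) as H.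
  assert (H12 : 0 < 12 ^ S n) by (apply pow_lt; lra).
  assert (H2 : 0 < 2 ^ n) by (apply pow_lt; lra).
  assert (H3 : 0 < 3 ^ S n) by (apply pow_lt; lra).
  apply Rmult_le_reg_r with (12 ^ S n); [exact H12|].
  rewrite Rmult_assoc, Rinv_l, Rmult_1_r by lra.
  eapply Rle_trans; [exact H|].
  replace 12 with (3 * (2 * 2)) by ring. rewrite !Rpow_mult_distr.
  replace (INR (fact n) * / 2 ^ n * (3 ^ S n * (2 ^ S n * 2 ^ S n)))
    with (3 ^ S n * (INR (fact n) * (2 * 2 ^ S n))) by (simpl pow; field; lra).
  apply Rmult_le_compat_l; [lra|]. rewrite fact_simpl, mult_INR, Rmult_comm.
  apply Rmult_le_compat_l; [apply pos_INR|].
  assert (INR (S n) <= 2 ^ S n); [|assert (0 < 2 ^ S n) by (apply pow_lt; lra); lra].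
  replace 2 with (INR 2) by reflexivity. rewrite <- pow_INR. apply le_INR.
  apply Nat.lt_le_incl. apply Nat.pow_gt_lin_r. lia.
Qed.

Lemma cdiff_cprod (f : nat -> C -> C) (n : nat) (a : C) :
  (forall i, cdiff (f i) a) -> cdiff (fun z => cprod (fun i => f i z) n) a.
Proof.
  intros H. induction n as [|n IH]; simpl; [apply cdiff_const|].
  now apply cdiff_mult.
Qed.

(* A weak form of Polya's theorem.  If [|F o G|] stays below [max_modulus F rho]
   on a disc then [G] keeps a positive distance there from a point [w t] of each
   modulus [t >= rho].  The product of [G - w t] over [n] equidistant [t] in
   [[rho, 2 rho)] is then bounded below by [(c rho)^n] for large [n], and
   Harnack's inequality bounds it above by [(c' rho)^n]. *)
Lemma polya (F G : C -> C) (r rho : R) :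
  entire F -> entire G -> 0 < r -> 0 < rho -> Cmod (G 0) <= rho ->
  max_modulus (fun z => F (G z)) r < max_modulus F rho ->
  max_modulus G (r / 3) <= 218 * rho.
Proof.
  intros HF HG Hr Hrho HG0 Hlt.
  set (A := max_modulus (fun z => F (G z)) r) in *.
  set (A' := max_modulus F rho) in *.
  destruct (entire_lipschitz_on_disc F (4 * rho) HF ltac:(lra)) as (L & HL & Lip).
  (* If [|G z| <= 4 rho], the Lipschitz bound turns the gap [A' - A] into a distance from [G z] to
     [w i]. Otherwise [w i], of modulus at most [2 rho], is farther than [rho] from [G z], whence
     the cap at 1. *)
  set (d := Rmin ((A' - A) / L / rho) 1).
  assert (Hd : 0 < d).
  { apply Rmin_pos; [|lra]. repeat apply Rdiv_lt_0_compat; lra. }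
  (* With [(1 / 2)^n < d], the single factor [d] of the lower bound is absorbed by passing from
     [rho / 12] to [rho / 24]. *)
  destruct (pow_lt_1_zero (1 / 2)) with (y := d) as (N & HN);
    [rewrite Rabs_pos_eq; lra | exact Hd |].
  specialize (HN (S N) ltac:(lia)). set (n := S N) in *.
  assert (Hhalf : 0 < (1 / 2) ^ n) by (apply pow_lt; lra).
  rewrite Rabs_pos_eq in HN by lra.
  assert (Pn : 0 < INR n) by (apply lt_0_INR; unfold n; lia).
  set (t := fun i : nat => rho * (1 + INR i / INR n)).
  assert (Ht : forall i, (i < n)%nat -> rho <= t i <= 2 * rho).
  { intros i Hi. assert (0 <= INR i / INR n <= 1).
    { split; [apply Rdiv_le_0_compat; [apply pos_INR | exact Pn]|].
      apply Rmult_le_reg_r with (INR n); [exact Pn|].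
      unfold Rdiv. rewrite Rmult_assoc, Rinv_l, Rmult_1_r, Rmult_1_l by lra.
      apply le_INR. lia. }
    unfold t. nra. }
  assert (Hw : forall i, exists w, (i < n)%nat -> Cmod w = t i /\ A' <= Cmod (F w)).
  { intros i. destruct (Nat.lt_ge_cases i n) as [Hi|Hi]; [|exists 0; lia].
    pose proof (Ht i Hi).
    destruct (max_modulus_spec F (t i) HF ltac:(lra)) as (w & Hw & E & _).
    exists w. intros _. split; [exact Hw|]. rewrite <- E.
    apply max_modulus_mono; [exact HF | lra | lra]. }
  apply choice in Hw. destruct Hw as (w & Hw).
  set (P := fun z => cprod (fun i => G z + - w i)%C n).
  assert (HP : entire P).
  { apply entire_cdiff. intros z. apply (cdiff_cprod (fun i z => G z + - w i)%C).
    intros i. apply cdiff_plus; [now apply entire_cdiff | apply cdiff_const]. }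
  assert (HFG : entire (fun z => F (G z))) by now apply entire_comp.
  assert (Hsep : forall z i, Cmod z <= r -> (i < n)%nat -> rho * d <= Cmod (G z - w i)).
  { intros z i Hz Hi. destruct (Hw i Hi) as (W1 & W2). specialize (Ht i Hi).
    destruct (Rle_dec (Cmod (G z)) (4 * rho)) as [Hs|Hs].
    - assert (H1 := Lip (G z) (w i) Hs ltac:(lra)).
      assert (H2 : Cmod (F (G z)) <= A)
        by (apply (le_max_modulus (fun z => F (G z))); assumption).
      pose proof (Cmod_triangle_rev (F (w i)) (F (G z))) as T.
      rewrite Cmod_minus_sym in T.
      apply Rmult_le_reg_l with L; [exact HL|].
      apply Rle_trans with (A' - A); [|lra].
      replace (A' - A) with (L * (rho * ((A' - A) / L / rho))) by (field; lra).
      apply Rmult_le_compat_l; [lra|]. apply Rmult_le_compat_l; [lra|]. apply Rmin_l.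
    - pose proof (Cmod_triangle_rev (G z) (w i)).
      assert (rho * d <= rho * 1) by (apply Rmult_le_compat_l; [lra | apply Rmin_r]).
      lra. }
  assert (Hlow : forall z, Cmod z <= r -> (rho / 24) ^ n <= Cmod (P z)).
  { intros z Hz. unfold P. rewrite Cmod_cprod.
    (* Measured from [rho] in units of [rho / n], the moduli [t i] are the integers [i], and [|G z|]
       is [y]. *)
    set (y := INR n * (Cmod (G z) / rho - 1)).
    apply Rle_trans with
      (rprod (fun i => rho / INR n * Rmax (Rabs (y - INR i)) d) n).
    - rewrite rprod_scal.
      apply Rle_trans with ((rho / INR n) ^ n * ((INR n / 12) ^ n * d)).
      + replace ((rho / INR n) ^ n * ((INR n / 12) ^ n * d)) with ((rho / 12) ^ n * d).
        2:{ rewrite <- Rmult_assoc, <- Rpow_mult_distr. do 2 f_equal. field. lra. }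
        replace (rho / 24) with (rho / 12 * (1 / 2)) by field.
        rewrite Rpow_mult_distr. apply Rmult_le_compat_l; [apply pow_le; lra | lra].
      + apply Rmult_le_compat_l.
        * apply pow_le. apply Rdiv_le_0_compat; lra.
        * apply rprod_dist_lower; [unfold n; lia | exact Hd].
    - apply rprod_le. intros i Hi. destruct (Hw i Hi) as (W1 & _).
      assert (Pq : 0 < rho / INR n) by now apply Rdiv_lt_0_compat.
      split.
      { apply Rmult_le_pos; [lra|]. pose proof (Rmax_r (Rabs (y - INR i)) d). lra. }
      change (rho / INR n * Rmax (Rabs (y - INR i)) d <= Cmod (G z - w i)).
      unfold Rmax. destruct (Rle_dec (Rabs (y - INR i)) d) as [_|_].
      + eapply Rle_trans; [|now apply Hsep].
        apply Rmult_le_compat_r; [lra|].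
        assert (1 <= INR n) by (apply (le_INR 1); unfold n; lia).
        apply Rmult_le_reg_r with (INR n); [exact Pn|].
        unfold Rdiv. rewrite Rmult_assoc, Rinv_l, Rmult_1_r by lra. nra.
      + rewrite <- (Rabs_pos_eq (rho / INR n)) by lra. rewrite <- Rabs_mult.
        replace (rho / INR n * (y - INR i)) with (Cmod (G z) - Cmod (w i)).
        2:{ rewrite W1. unfold y, t. field. lra. }
        apply Rabs_le. pose proof (Cmod_triangle_rev (G z) (w i)).
        pose proof (Cmod_triangle_rev (w i) (G z)) as T.
        rewrite Cmod_minus_sym in T. lra. }
  assert (Hup0 : Cmod (P 0) <= (3 * rho) ^ n).
  { unfold P. rewrite Cmod_cprod, <- rprod_const. apply rprod_le. intros i Hi.
    split; [apply Cmod_ge_0|]. destruct (Hw i Hi) as (W1 & _). specialize (Ht i Hi).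
    pose proof (Cmod_triangle_minus (G 0) (w i)) as T.
    change (Cmod (G 0 - w i) <= 3 * rho). lra. }
  assert (HP0 : 0 < Cmod (P 0)).
  { eapply Rlt_le_trans; [|apply Hlow; rewrite Cmod_0; lra]. apply pow_lt. lra. }
  (* Per factor, [|P 0|] is at most [3 rho] and the lower bound is [rho / 24]: their ratio is 72.
     Harnack's inequality then allows [72 * 3 rho = 216 rho] per factor, and the modulus of [w i]
     adds [2 rho], which makes 218. *)
  assert (Hln : 0 < ln 72) by (rewrite <- ln_1; apply ln_increasing; lra).
  assert (Hexp : exp (INR n * ln 72) = 72 ^ n).
  { rewrite <- (exp_ln 72) at 2 by lra. apply exp_INR_mult. }
  assert (H72 : 0 < 72 ^ n) by (apply pow_lt; lra).
  assert (Hup : forall z, Cmod z <= r / 3 -> Cmod (P z) <= (216 * rho) ^ n).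
  { intros z Hz.
    assert (H : Cmod (P z) <= exp (INR n * ln 72) * Cmod (P 0)).
    { apply (harnack_nonvanishing P r); auto.
      - apply Rmult_le_pos; lra.
      - now apply Cmod_gt_0.
      - intros u Hu. eapply Rle_trans; [|now apply Hlow].
        rewrite exp_Ropp, Hexp.
        apply Rmult_le_reg_l with (72 ^ n); [exact H72|].
        rewrite <- Rmult_assoc, Rinv_r, Rmult_1_l by lra.
        rewrite <- Rpow_mult_distr.
        replace (72 * (rho / 24)) with (3 * rho) by field. exact Hup0. }
    rewrite Hexp in H. eapply Rle_trans; [exact H|].
    replace (216 * rho) with (72 * (3 * rho)) by ring. rewrite Rpow_mult_distr.
    apply Rmult_le_compat_l; lra. }
  destruct (max_modulus_spec G (r / 3) HG ltac:(lra)) as (z & Hz & -> & _).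
  apply Rnot_lt_le. intros Hbig. specialize (Hup z ltac:(lra)).
  assert (Hgt : (Cmod (G z) - 2 * rho) ^ n <= Cmod (P z)).
  { unfold P. rewrite Cmod_cprod, <- rprod_const. apply rprod_le. intros i Hi.
    split; [lra|]. destruct (Hw i Hi) as (W1 & _). specialize (Ht i Hi).
    pose proof (Cmod_triangle_rev (G z) (w i)).
    change (Cmod (G z) - 2 * rho <= Cmod (G z - w i)). lra. }
  assert (H1 : (216 * rho) ^ n < (Cmod (G z) - 2 * rho) ^ n).
  { apply pow_S_lt_compat; lra. }
  lra.
Qed.

(** * Growth of composite functions *)

Lemma interior_annulus (f : C -> C) (a : C) (r s : R) :
  r < Cmod a < s -> (forall z, r <= Cmod z <= s -> cdiff f z) ->
  interior_cdiff (fun z => Cmod z <= s /\ r <= Cmod z) f a.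
Proof.
  intros Ha Hd.
  assert (HK : forall z, Cmod (z - a) <= Rmin (Cmod a - r) (s - Cmod a) ->
                 Cmod z <= s /\ r <= Cmod z).
  { intros z Hz. pose proof (Rmin_l (Cmod a - r) (s - Cmod a)).
    pose proof (Rmin_r (Cmod a - r) (s - Cmod a)).
    pose proof (Cmod_triangle_rev z a). pose proof (Cmod_triangle_rev a z) as T.
    rewrite Cmod_minus_sym in T. lra. }
  exists (Rmin (Cmod a - r) (s - Cmod a)). split; [apply Rmin_pos; lra|].
  split; [exact HK|]. intros z (_ & Hz). specialize (HK z Hz). apply Hd. lra.
Qed.

Lemma max_principle_annulus (f : C -> C) (r s B : R) :
  0 <= B -> (forall z, r <= Cmod z <= s -> cdiff f z) ->
  (forall z, Cmod z = r \/ Cmod z = s -> Cmod (f z) <= B) ->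
  forall z, r <= Cmod z <= s -> Cmod (f z) <= B.
Proof.
  intros HB Hd Hbd z Hz.
  apply (max_principle (fun z => Cmod z <= s /\ r <= Cmod z) f B s); [exact HB| | | | |tauto].
  - apply cclosed_and; [apply cclosed_disc_0 | apply cclosed_outside].
  - tauto.
  - intros w Hw. apply cdiff_ccont, Hd. tauto.
  - intros a (H1 & H2).
    destruct (Rle_lt_or_eq_dec _ _ H1) as [L1|E1]; [|left; apply Hbd; now right].
    destruct (Rle_lt_or_eq_dec _ _ H2) as [L2|E2]; [|left; apply Hbd; now left].
    right. now apply interior_annulus.
Qed.

(* Hadamard's three circles theorem for the radii [1], [r] and [r ^ n], up to an
   additive constant: the maximum principle is applied to [f ^ q / z ^ m] with
   [m / q] close to the slope of the chord and [q >= ln r]. *)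
Lemma three_circles (f : C -> C) (n : nat) (r : R) :
  entire f -> (1 <= n)%nat -> 1 < r -> 0 < max_modulus f r ->
  Rmax 1 (max_modulus f 1) < max_modulus f (r ^ n) ->
  INR n * (ln (max_modulus f r) - ln (Rmax 1 (max_modulus f 1)) - 1)
    <= ln (max_modulus f (r ^ n)).
Proof.
  intros Hf Hn Hr Hpos Hlt.
  set (B := Rmax 1 (max_modulus f 1)) in *. set (Y := max_modulus f (r ^ n)) in *.
  assert (HB1 : 1 <= B) by apply Rmax_l.
  assert (Pn : 1 <= INR n) by (apply (le_INR 1); exact Hn).
  assert (Hu : 0 < ln r) by (rewrite <- ln_1; apply ln_increasing; lra).
  assert (Hb : 0 <= ln B) by (rewrite <- ln_1; apply ln_le; lra).
  assert (Hy : ln B < ln Y) by (apply ln_increasing; lra).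
  assert (Hrn : r <= r ^ n).
  { rewrite <- (pow_1 r) at 1. apply Rle_pow; [lra | exact Hn]. }
  (* Rounding the exponent below costs at most [n ln r]; after division by [q > ln r] this is less
     than the [n] conceded by the term [- 1] in the statement. *)
  destruct (INR_unbounded (1 + ln r)) as (q & Hq).
  assert (Hnu : 0 < INR n * ln r) by (apply Rmult_lt_0_compat; lra).
  (* [x / q] is the slope of the chord from [(0, ln B)] to [(n ln r, ln Y)]. Rounding [x] up to [m]
     keeps the bound [B ^ q] valid on the outer circle. *)
  set (x := INR q * (ln Y - ln B) / (INR n * ln r)).
  assert (Hx : 0 <= x).
  { apply Rdiv_le_0_compat; [|exact Hnu]. apply Rmult_le_pos; lra. }
  destruct (nfloor_ex x Hx) as (m0 & Hm0 & Hm1).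
  set (m := S m0). assert (Em : INR m = INR m0 + 1) by apply S_INR.
  assert (Hexp : forall (t : R) (i : nat), 0 < t -> t ^ i = exp (INR i * ln t)).
  { intros t i Ht. now rewrite exp_INR_mult, exp_ln. }
  assert (Hne : forall z, 1 <= Cmod z -> z <> 0).
  { intros z Hz. apply Cmod_gt_0. lra. }
  assert (Hnz : forall z, 1 <= Cmod z -> (z ^ m)%C <> 0).
  { intros z Hz. apply Cpow_nz. now apply Hne. }
  assert (Hmod : forall z, 1 <= Cmod z ->
     Cmod (f z ^ q * / z ^ m) = Cmod (f z) ^ q / Cmod z ^ m).
  { intros z Hz. rewrite Cmod_mult, Cmod_inv, !Cmod_pow by now apply Hnz. reflexivity. }
  destruct (max_modulus_spec f r Hf ltac:(lra)) as (w & Hw & Ew & _).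
  assert (Hle : Cmod (f w ^ q * / w ^ m) <= B ^ q).
  { apply (max_principle_annulus (fun z => f z ^ q * / z ^ m)%C 1 (r ^ n));
      [apply pow_le; lra | | | lra].
    - intros z (Hz & _). apply cdiff_mult; [apply cdiff_pow; now apply entire_cdiff|].
      apply cdiff_inv; [now apply Hnz|]. apply (cdiff_pow (fun z => z)), cdiff_id.
    - intros z [Hz|Hz]; rewrite Hmod by lra; rewrite Hz.
      + rewrite pow1. unfold Rdiv. rewrite Rinv_1, Rmult_1_r.
        apply pow_incr. split; [apply Cmod_ge_0|].
        eapply Rle_trans; [|apply Rmax_r]. apply le_max_modulus; [exact Hf | lra].
      + assert (Hp : 0 < (r ^ n) ^ m) by (apply pow_lt; lra).
        apply Rmult_le_reg_r with ((r ^ n) ^ m); [exact Hp|].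
        unfold Rdiv. rewrite Rmult_assoc, Rinv_l, Rmult_1_r by lra.
        apply Rle_trans with (Y ^ q).
        { apply pow_incr. split; [apply Cmod_ge_0|].
          apply le_max_modulus; [exact Hf | lra]. }
        rewrite <- pow_mult, !Hexp, mult_INR, <- exp_plus by lra.
        apply exp_le_compat.
        assert (x * (INR n * ln r) <= INR m * (INR n * ln r))
          by (apply Rmult_le_compat_r; lra).
        assert (x * (INR n * ln r) = INR q * (ln Y - ln B))
          by (unfold x; field; lra).
        lra. }
  rewrite Hmod, Hw, <- Ew in Hle by lra.
  assert (Hp : 0 < r ^ m) by (apply pow_lt; lra).
  assert (Hle2 : max_modulus f r ^ q <= B ^ q * r ^ m).
  { apply Rmult_le_compat_r with (r := r ^ m) in Hle; [|lra].
    unfold Rdiv in Hle. rewrite Rmult_assoc, Rinv_l, Rmult_1_r in Hle by lra. exact Hle. }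
  rewrite !Hexp, <- exp_plus in Hle2 by lra.
  assert (Hle3 : INR q * ln (max_modulus f r) <= INR q * ln B + INR m * ln r).
  { apply Rnot_lt_le. intros H. apply exp_increasing in H. lra. }
  assert (Hm2 : INR m * ln r * INR n <= INR q * (ln Y - ln B) + INR n * ln r).
  { replace (INR q * (ln Y - ln B)) with (x * (INR n * ln r))
      by (unfold x; field; lra).
    assert (INR m0 * (INR n * ln r) <= x * (INR n * ln r))
      by (apply Rmult_le_compat_r; lra).
    rewrite Em. lra. }
  apply Rmult_le_reg_l with (INR q); [lra|].
  apply Rmult_le_compat_r with (r := INR n) in Hle3; [|lra].
  assert (INR n * ln r <= INR n * INR q) by (apply Rmult_le_compat_l; lra).
  assert (0 <= INR q * ln B) by (apply Rmult_le_pos; lra).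
  lra.
Qed.

Lemma max_modulus_unbounded (f : C -> C) (B : R) :
  transcendental_entire f ->
  exists R0, 0 < R0 /\ forall r, R0 <= r -> B <= max_modulus f r.
Proof.
  intros Hf. destruct (transcendental_not_constant f Hf) as (z0 & Hz0).
  destruct (liouville f z0 (proj1 Hf) Hz0) as (c & d & Hc & H).
  exists (Rmax (1 + Cmod z0) ((B + d) / c)). pose proof (Cmod_ge_0 z0).
  split; [eapply Rlt_le_trans; [|apply Rmax_l]; lra|]. intros r Hr.
  pose proof (Rmax_l (1 + Cmod z0) ((B + d) / c)).
  pose proof (Rmax_r (1 + Cmod z0) ((B + d) / c)).
  specialize (H r ltac:(lra)).
  assert (c * ((B + d) / c) <= c * r) by (apply Rmult_le_compat_l; lra).
  replace (c * ((B + d) / c)) with (B + d) in * by (field; lra). lra.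
Qed.

(** * Polynomial growth against log-regular growth *)

Lemma ln_0 : ln 0 = 0.
Proof. unfold ln. now destruct (Rlt_dec 0 0) as [H|]; [destruct (Rlt_irrefl 0)|]. Qed.

Lemma polynomial_bound (p : C -> C) :
  polynomial_function p ->
  exists n A, 0 < A /\ forall z, 1 <= Cmod z -> Cmod (p z) <= A * Cmod z ^ n.
Proof.
  intros (n & a & Hp). exists n.
  assert (H : exists A, 0 < A /\ forall z, 1 <= Cmod z ->
     Cmod (sum_n (fun k => (a k * z ^ k)%C) n) <= A * Cmod z ^ n).
  { clear Hp p. induction n as [|n (A & HA & IH)].
    - exists (1 + Cmod (a O)). pose proof (Cmod_ge_0 (a O)). split; [lra|].
      intros z _. rewrite sum_O. simpl. rewrite Cmult_1_r. lra.
    - exists (A + Cmod (a (S n))). pose proof (Cmod_ge_0 (a (S n))). split; [lra|].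
      intros z Hz. rewrite sum_Sn.
      change (Cmod (sum_n (fun k => (a k * z ^ k)%C) n + a (S n) * z ^ S n)
              <= (A + Cmod (a (S n))) * Cmod z ^ S n).
      eapply Rle_trans; [apply Cmod_triangle|]. rewrite Cmod_mult, Cmod_pow.
      specialize (IH z Hz).
      assert (A * Cmod z ^ n <= A * Cmod z ^ S n).
      { apply Rmult_le_compat_l; [lra|]. apply Rle_pow; [exact Hz | lia]. }
      lra. }
  destruct H as (A & HA & H). exists A. split; [exact HA|].
  intros z Hz. rewrite Hp. now apply H.
Qed.

(** The growth condition for a single [eps], stated apart from transcendence because the case
    [eps = 1/2] is what proves that the composition is transcendental. *)
Definition log_regular_growth (f : C -> C) (eps : R) : Prop :=
  exists R0 k : R, 0 < R0 /\ 1 < k /\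
    forall r : R, R0 < r ->
      ln (max_modulus f (Rpower r k))
        >= Rpower (k * ln (max_modulus f r)) (1 / eps).

(** Put [u = ln r]. For a polynomial, log M(r^k) is at most [N u]. The linear lower bound gives log
    M(r) >= [u / 2], so growth with exponent 2 gives log M(r^k) >= [(u / 2)^2], which is larger once
    [u > 4 N]. *)
Lemma log_regular_growth_not_polynomial (f : C -> C) (z0 : C) :
  entire f -> f z0 <> f 0 -> log_regular_growth f (1 / 2) ->
  ~ polynomial_function f.
Proof.
  intros Hf Hz0 (R0 & k & HR0 & Hk & Hgr) Hp.
  destruct (polynomial_bound f Hp) as (n & A & HA & Hpb).
  destruct (liouville f z0 Hf Hz0) as (c & d & Hc & Hlow).
  set (N := Rabs (ln A) + INR n * k).
  assert (HN : 0 <= INR n * k /\ Rabs (ln A) <= N).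
  { pose proof (pos_INR n). assert (0 <= INR n * k) by (apply Rmult_le_pos; lra).
    unfold N. lra. }
  (* The exponential makes [u > 4 N]; [R0] and [Cmod z0] admit [r] in the two growth bounds; the
     last two summands give [c r - d >= sqrt r]. *)
  set (r := exp (4 * N + 1) + R0 + Cmod z0 + 2 * Rabs d / c + 4 / (c * c)).
  pose proof (Cmod_ge_0 z0). pose proof (Rabs_pos (ln A)).
  assert (Hd : 0 <= 2 * Rabs d / c).
  { apply Rdiv_le_0_compat; [|exact Hc]. pose proof (Rabs_pos d). lra. }
  assert (Hcc : 0 < 4 / (c * c)).
  { apply Rdiv_lt_0_compat; [lra|]. now apply Rmult_lt_0_compat. }
  assert (He : 1 < exp (4 * N + 1)).
  { rewrite <- exp_0 at 1. apply exp_increasing. lra. }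
  assert (Hr1 : exp (4 * N + 1) < r) by (unfold r; lra).
  set (u := ln r).
  assert (Hu : 4 * N + 1 < u).
  { unfold u. rewrite <- (ln_exp (4 * N + 1)). apply ln_increasing; [apply exp_pos | exact Hr1]. }
  assert (Hs : sqrt r <= max_modulus f r).
  { eapply Rle_trans; [|apply Hlow; unfold r; lra].
    assert (H2 : 2 / c <= sqrt r).
    { rewrite <- (sqrt_pow2 (2 / c)) by (apply Rdiv_le_0_compat; lra).
      apply sqrt_le_1_alt. replace ((2 / c) ^ 2) with (4 / (c * c)) by (field; lra).
      unfold r. lra. }
    assert (H3 : 2 * Rabs d / c <= r) by (unfold r; lra).
    apply Rmult_le_compat_l with (r := c / 2) in H3; [|lra].
    replace (c / 2 * (2 * Rabs d / c)) with (Rabs d) in H3 by (field; lra).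
    pose proof (Rle_abs d).
    assert (H4 : sqrt r <= c / 2 * r); [|lra].
    rewrite <- (sqrt_sqrt r) at 2 by lra.
    apply Rmult_le_compat_l with (r := c / 2) in H2; [|lra].
    replace (c / 2 * (2 / c)) with 1 in H2 by (field; lra).
    pose proof (sqrt_pos r). rewrite <- Rmult_assoc. rewrite <- (Rmult_1_l (sqrt r)) at 1.
    apply Rmult_le_compat_r; lra. }
  assert (Hsq : 0 < sqrt r) by (apply sqrt_lt_R0; lra).
  assert (Hl : u / 2 <= ln (max_modulus f r)).
  { unfold u. rewrite <- (sqrt_sqrt r) at 1 by lra. rewrite ln_mult by exact Hsq.
    apply ln_le in Hs; [lra | exact Hsq]. }
  specialize (Hgr r ltac:(unfold r; lra)). apply Rge_le in Hgr.
  replace (1 / (1 / 2)) with (INR 2) in Hgr by (simpl; field).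
  assert (Hkl : u / 2 <= k * ln (max_modulus f r)) by nra.
  rewrite Rpower_pow in Hgr by lra.
  assert (Hrk : 1 <= Rpower r k).
  { rewrite <- (Rpower_O r) by lra. apply Rle_Rpower; lra. }
  assert (Hup : ln (max_modulus f (Rpower r k)) <= N * u).
  { destruct (max_modulus_spec f (Rpower r k) Hf ltac:(lra)) as (w & Hw & -> & _).
    specialize (Hpb w ltac:(lra)).
    assert (0 <= N * u) by (apply Rmult_le_pos; lra).
    destruct (Rle_lt_or_eq_dec 0 (Cmod (f w)) (Cmod_ge_0 _)) as [Hpos|E0].
    - apply ln_le in Hpb; [|exact Hpos].
      assert (HP : 0 < Cmod w ^ n) by (apply pow_lt; lra).
      rewrite ln_mult, ln_pow, Hw in Hpb by lra.
      rewrite ln_Rpower in Hpb. fold u in Hpb.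
      pose proof (Rle_abs (ln A)).
      assert (Rabs (ln A) * 1 <= Rabs (ln A) * u) by (apply Rmult_le_compat_l; lra).
      unfold N. lra.
    (* If the maximum modulus is 0, the default value [ln 0 = 0] still lies below [N u]. *)
    - rewrite <- E0, ln_0. lra. }
  assert (Hsquare : (u / 2) ^ 2 <= (k * ln (max_modulus f r)) ^ 2)
    by (apply pow_incr; lra).
  assert (4 * N * u < u * u) by (apply Rmult_lt_compat_r; lra).
  lra.
Qed.

(** * Maximum modulus of a composition *)

Lemma max_modulus_comp_le (F G : C -> C) (r : R) :
  entire F -> entire G -> 0 <= r ->
  max_modulus (fun z => F (G z)) r <= max_modulus F (max_modulus G r).
Proof.
  intros HF HG Hr.
  destruct (max_modulus_spec (fun z => F (G z)) r (entire_comp F G HF HG) Hr)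
    as (w & Hw & -> & _).
  apply le_max_modulus; [exact HF|]. apply le_max_modulus; [exact HG | lra].
Qed.

Lemma max_modulus_comp_ge (F G : C -> C) (r rho : R) :
  entire F -> entire G -> 0 < r -> 0 < rho -> Cmod (G 0) <= rho ->
  218 * rho < max_modulus G (r / 3) ->
  max_modulus F rho <= max_modulus (fun z => F (G z)) r.
Proof.
  intros HF HG Hr Hrho H0 Hlt. apply Rnot_lt_le. intros H.
  pose proof (polya F G r rho HF HG Hr Hrho H0 H). lra.
Qed.

Lemma max_modulus_comp_unbounded (F G : C -> C) (B : R) :
  transcendental_entire F -> transcendental_entire G ->
  exists R0, 0 < R0 /\ forall r, R0 <= r -> B <= max_modulus (fun z => F (G z)) r.
Proof.
  intros HF HG. destruct (max_modulus_unbounded F B HF) as (rho & Hrho & HB).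
  pose proof (Cmod_ge_0 (G 0)).
  set (s := rho + Cmod (G 0)).
  destruct (max_modulus_unbounded G (218 * s + 1) HG) as (R0 & HR0 & HG0).
  exists (3 * R0). split; [lra|]. intros r Hr.
  apply Rle_trans with (max_modulus F s); [apply HB; unfold s; lra|].
  apply max_modulus_comp_ge; [apply HF | apply HG | lra | unfold s; lra
                             | unfold s; lra |].
  specialize (HG0 (r / 3) ltac:(lra)). lra.
Qed.

Lemma log_regular_growth_comp (F G : C -> C) (eps : R) :
  strongly_log_regular F -> transcendental_entire G -> 0 < eps < 1 ->
  log_regular_growth (fun z => F (G z)) eps.
Proof.
  intros (HF & HFreg) HG Heps.
  destruct (HFreg (eps / 2) ltac:(lra)) as (R1 & k & HR1 & Hk & Hreg).
  (* Since [n - k > 1], a full [ln t] is left to outweigh the loss [n (b + 1)] of the three circles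
     theorem and [ln 218]. The additional 1 in [k'] gives a factor [r >= 3] against the division of
     the radius by 3. *)
  destruct (INR_unbounded (k + 1)) as (n & Hn).
  set (k' := INR n + 1). set (b := ln (Rmax 1 (max_modulus G 1))).
  (* One summand for each demand on [t]: the range of regularity of [F], the bound on [G 0] in
     Polya's theorem, the additive losses, and the strict inequality assumed in [three_circles]. *)
  set (T := R1 + Cmod (G 0) + exp (INR n * (b + 1) + ln 218 + 1)
            + Rmax 1 (max_modulus G 1)).
  destruct (max_modulus_unbounded G T HG) as (R2 & HR2 & HGT).
  (* The bound [exp k'] makes [y >= k'] below, so that [k' y <= y^2 <= (k x)^2]. *)
  destruct (max_modulus_comp_unbounded F G (exp k') HF HG) as (R3 & HR3 & HFG).
  exists (3 + R2 + R3), k'. split; [lra|]. split; [unfold k'; lra|]. intros r Hr.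
  specialize (HGT r ltac:(lra)). specialize (HFG r ltac:(lra)).
  set (t := max_modulus G r) in *.
  pose proof (Cmod_ge_0 (G 0)). pose proof (Rmax_l 1 (max_modulus G 1)).
  set (E := INR n * (b + 1) + ln 218 + 1) in *.
  pose proof (exp_pos E).
  assert (HtE : exp E <= t) by (unfold T in HGT; lra).
  assert (Ht1 : 1 <= t) by (unfold T in HGT; lra).
  assert (HtR : R1 < t) by (unfold T in HGT; lra).
  assert (Ht0 : Cmod (G 0) <= t) by (unfold T in HGT; lra).
  assert (HtB : Rmax 1 (max_modulus G 1) < t) by (unfold T in HGT; lra).
  set (rho := Rpower t k).
  assert (Hrho : t <= rho).
  { unfold rho. rewrite <- (Rpower_1 t) at 1 by lra. apply Rle_Rpower; lra. }
  assert (Hrn : Rpower r k' = r ^ n * r).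
  { unfold k'. rewrite Rpower_plus, Rpower_pow, Rpower_1 by lra. reflexivity. }
  assert (Hn1 : (1 <= n)%nat).
  { apply INR_le. simpl. lra. }
  assert (Hrr : r <= r ^ n).
  { rewrite <- (pow_1 r) at 1. apply Rle_pow; [lra | exact Hn1]. }
  assert (Hge : max_modulus F rho <= max_modulus (fun z => F (G z)) (Rpower r k')).
  { apply max_modulus_comp_ge; [apply HF | apply HG | apply exp_pos | lra | lra |].
    apply Rlt_le_trans with (max_modulus G (r ^ n)).
    - assert (Hmono : t <= max_modulus G (r ^ n))
        by (apply max_modulus_mono; [apply HG | lra | exact Hrr]).
      pose proof (three_circles G n r (proj1 HG) Hn1 ltac:(lra)) as H3.
      fold t b in H3. specialize (H3 ltac:(lra) ltac:(lra)).
      assert (HlnE : E <= ln t).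
      { rewrite <- (ln_exp E). apply ln_le; [apply exp_pos | exact HtE]. }
      assert (Hlt0 : 0 <= ln t) by (rewrite <- ln_1; apply ln_le; lra).
      apply ln_lt_inv; [lra | lra |].
      unfold rho. rewrite ln_mult, ln_Rpower by (lra || apply exp_pos).
      assert (1 * ln t <= (INR n - k) * ln t) by (apply Rmult_le_compat_r; lra).
      unfold E in HlnE. lra.
    - apply max_modulus_mono; [apply HG | lra |]. rewrite Hrn. nra. }
  assert (HFt : max_modulus (fun z => F (G z)) r <= max_modulus F t)
    by (apply max_modulus_comp_le; [apply HF | apply HG | lra]).
  pose proof (exp_pos k').
  set (y := ln (max_modulus (fun z => F (G z)) r)) in *.
  set (x := ln (max_modulus F t)).
  assert (Hy : k' <= y) by (unfold y; rewrite <- (ln_exp k'); apply ln_le; lra).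
  assert (Hxy : y <= x) by (apply ln_le; lra).
  specialize (Hreg t HtR). fold x rho in Hreg. apply Rge_le in Hreg. apply Rle_ge.
  assert (HFpos : max_modulus F t <= max_modulus F rho)
    by (apply max_modulus_mono; [apply HF | lra | exact Hrho]).
  apply Rle_trans with (ln (max_modulus F rho)); [|apply ln_le; lra].
  eapply Rle_trans; [|exact Hreg].
  assert (Hk' : 1 < k') by (unfold k'; lra).
  assert (Hkx : k' * y <= Rpower (k * x) (INR 2)).
  { assert (y <= k * x) by nra. rewrite Rpower_pow by lra. simpl. rewrite Rmult_1_r.
    apply Rmult_le_compat; lra. }
  replace (1 / (eps / 2)) with (INR 2 * (1 / eps)) by (simpl; field; lra).
  rewrite <- Rpower_mult. apply Rle_Rpower_l.
  - apply Rdiv_le_0_compat; lra.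
  - split; [|exact Hkx]. apply Rmult_lt_0_compat; lra.
Qed.

Lemma strongly_log_regular_comp (F G : C -> C) :
  strongly_log_regular F -> transcendental_entire G ->
  strongly_log_regular (fun z => F (G z)).
Proof.
  intros HF HG.
  assert (He : entire (fun z => F (G z))) by (apply entire_comp; [apply HF | apply HG]).
  split; [split; [exact He|] | intros eps Heps; now apply log_regular_growth_comp].
  (* The unboundedness of the composition supplies the non-constancy on which its linear lower bound
     depends. *)
  assert (Hne : exists z0, F (G z0) <> F (G 0)).
  { destruct (max_modulus_comp_unbounded F G (Cmod (F (G 0)) + 1) (proj1 HF) HG)
      as (R0 & HR0 & H).
    destruct (max_modulus_spec _ R0 He ltac:(lra)) as (w & _ & E & _).
    exists w. intros E0. specialize (H R0 ltac:(lra)). rewrite E, E0 in H. lra. }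
  destruct Hne as (z0 & Hz0).
  apply (log_regular_growth_not_polynomial _ z0 He Hz0).
  apply log_regular_growth_comp; [exact HF | exact HG | lra].
Qed.

Theorem theorem3p1 (j : nat) (f : nat -> C -> C)
  (hj : (1 <= j)%nat)
  (hf : forall i : nat, (1 <= i <= j)%nat -> transcendental_entire (f i))
  (hf1 : strongly_log_regular (f 1%nat)) :
  strongly_log_regular (compose_upto f j).
Proof.
  induction j as [|j IH]; [lia|].
  destruct j as [|j]; [exact hf1|].
  (* The recursion splits off the innermost function, so the strongly log-regular factor given by
     induction is the outer one. *)
  apply (strongly_log_regular_comp (compose_upto f (S j)) (f (S (S j)))).
  - apply IH; [lia|]. intros i Hi. apply hf. lia.
  - apply hf. lia.
Qed.
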